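(* Let $d\geq 3$ be an integer and fix $\lambda$ with $0<\lambda<2^{-(d+\frac12)}$. Then, as $r\to 0$, the expected number of iterations of the while-loop in the partial rejection sampling algorithm for the hard spheres model in dimension $d$ with parameters $(\lambda,r)$ is $O(\log r^{-1})$. (Explicitly: there exist $C>0$ and $r_0\in(0,1)$ depending only on $d$ and $\lambda$ such that for all $0<r\le r_0$ this expectation is at most $C\log(1/r)$.)
   Context: Let $v_d$ be the volume of the unit ball in $\mathbb R^d$ and $\lambda_{r,d}=\lambda/(v_dr^d)$; $\|\cdot\|$ is the Euclidean norm. For a finite set $P\subset[0,1]^d$, let $\mathrm{BadPairs}(P)=\{\{x,y\}: x,y\in P,\ x\neq y,\ \|x-y\|<2r\}$ and $\mathrm{BadPoints}(P)=\bigcup \mathrm{BadPairs}(P)$, i.e. the set of points of $P$ belonging to some bad pair. $D_{2r}(\mathbf 0)$ is the open ball of radius $2r$ centred at the origin of $\mathbb R^d$, and $+$ denotes Minkowski sum. The hard spheres model is the law of a Poisson point process of intensity $\lambda_{r,d}$ on $[0,1]^d$ conditioned on no two distinct points being closer than $2r$. The partial rejection sampling algorithm in dimension $d$ with parameters $(\lambda,r)$: 1. Let $P$ be a sample of the Poisson point process of intensity $\lambda_{r,d}$ on $[0,1]^d$. 2. While $B:=\mathrm{BadPoints}(P)\neq\emptyset$: let $S=(B+D_{2r}(\mathbf 0))\cap[0,1]^d$; draw, using fresh independent randomness, a sample $P^S$ of the Poisson point process of intensity $\lambda_{r,d}$ on $S$; replace $P$ by $(P\setminus B)\cup P^S$.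 3. Halt and output $P$. *)

(* Defs.v *)
From HB Require Import structures.
From mathcomp Require Import all_boot all_order all_algebra finmap.
From mathcomp Require Import all_classical all_reals all_analysis.

Set Implicit Arguments.
Unset Strict Implicit.
Unset Printing Implicit Defensive.
Import Order.TTheory GRing.Theory Num.Theory.
Import numFieldNormedType.Exports.

Local Open Scope classical_set_scope.
Local Open Scope ring_scope.

(* The sigma-algebra on R^d = 'rV[R]_d is the one generated by the coordinates,
   i.e. the Borel sigma-algebra. *)
Section borel_rV.
Context {R : realType} {d : nat}.

Let coord : 'I_d -> 'rV[R]_d -> measurableTypeR R := fun i x => x ord0 i.

Let rV_set0 : g_sigma_preimage coord set0.
Proof. exact: sigma_algebra0. Qed.

Let rV_setC A : g_sigma_preimage coord A -> g_sigma_preimage coord (~` A).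
Proof. exact: sigma_algebraC. Qed.

Let rV_bigcup (F : (set 'rV[R]_d)^nat) :
  (forall i, g_sigma_preimage coord (F i)) ->
  g_sigma_preimage coord (\bigcup_i F i).
Proof. exact: sigma_algebra_bigcup. Qed.

HB.instance Definition _ := @isMeasurable.Build default_measure_display
  'rV[R]_d (g_sigma_preimage coord) rV_set0 rV_setC rV_bigcup.

Lemma measurable_coord (i : 'I_d) :
  measurable_fun [set: 'rV[R]_d] (fun x : 'rV[R]_d => x ord0 i).
Proof.
move=> _ Y mY; rewrite setTI; apply: sub_sigma_algebra => /=.
rewrite -bigcup_seq/=; exists i => /=; first by rewrite mem_index_enum.
by exists Y => //; rewrite setTI.
Qed.

Lemma measurable_fun_rVP d1 (T1 : measurableType d1) (f : T1 -> 'rV[R]_d) :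
  measurable_fun [set: T1] f <->
  forall i, measurable_fun [set: T1] (fun t => f t ord0 i).
Proof.
split=> [mf i|mf].
  by apply: (measurableT_comp (measurable_coord i)).
apply: (@measurability _ _ _ _ _ _
  (\big[setU/set0]_(i < d) preimage_set_system setT (coord i) measurable)) => //.
move=> _ [B + <-]; rewrite -bigcup_seq/= => -[i _ [Y mY <-]].
by rewrite setTI -[X in measurable X]setTI setTI; exact: (mf i measurableT _ mY).
Qed.

End borel_rV.

(* Lebesgue measure on R^d: the unit mass on R^0 and, on R^d.+1, the image of
   the product of the Lebesgue measures on R and R^d under concatenation. *)
Section lebesgue_rV.
Context {R : realType}.

Definition vcons d (p : measurableTypeR R * 'rV[R]_d) : 'rV[R]_d.+1 :=
  row_mx (const_mx p.1 : 'rV_1) p.2.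

Definition vuncons d (x : 'rV[R]_d.+1) : measurableTypeR R * 'rV[R]_d :=
  (x ord0 ord0, rsubmx (x : 'rV_(1 + d))).

Lemma vconsK d : cancel (@vcons d) (@vuncons d).
Proof.
case=> a v; rewrite /vuncons /vcons row_mxKr; congr pair.
have -> : (ord0 : 'I_d.+1) = lshift d (ord0 : 'I_1) by exact/val_inj.
exact: etrans (row_mxEl _ _ _ _) (mxE _ _ _ _).
Qed.

Lemma measurable_vcons d : measurable_fun [set: _] (@vcons d).
Proof.
apply/measurable_fun_rVP => i.
case: (@splitP 1 d i) => j ij.
  rewrite (_ : i = lshift d j); last exact/val_inj.
  rewrite (_ : (fun _ => _) = fst); first exact: measurable_fst.
  by apply/funext => p; exact: etrans (row_mxEl _ _ _ _) (mxE _ _ _ _).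
rewrite (_ : i = rshift 1 j); last exact/val_inj.
rewrite (_ : (fun _ => _) = (fun x : 'rV[R]_d => x ord0 j) \o snd).
  exact: (measurableT_comp (measurable_coord j) measurable_snd).
by apply/funext => p; exact: row_mxEr.
Qed.

Lemma measurable_vuncons d : measurable_fun [set: _] (@vuncons d).
Proof.
apply: measurable_fun_pair => /=; first exact: measurable_coord.
apply/measurable_fun_rVP => i.
rewrite (_ : (fun _ => _) =
  (fun x : 'rV[R]_d.+1 => x ord0 (rshift 1 i : 'I_d.+1))).
  exact: measurable_coord.
by apply/funext => x; rewrite mxE.
Qed.

Definition lebesgue_rVS d (m : {sigma_finite_measure set 'rV[R]_d -> \bar R}) :
  set 'rV[R]_d.+1 -> \bar R :=
  pushforward (lebesgue_measure \x m)%E (@vcons d).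

Section instances.
Context d (m : {sigma_finite_measure set 'rV[R]_d -> \bar R}).

Let M : {measure set 'rV[R]_d.+1 -> \bar R} :=
  measure_function_pushforward__canonical__measure_function_Measure
    (lebesgue_measure \x m)%E (@measurable_vcons d).

HB.instance Definition _ := isMeasure.Build _ _ _ (lebesgue_rVS m)
  (measure0 M) (measure_ge0 M) (@measure_semi_sigma_additive _ _ _ M).

Let lebesgue_rVS_sigma_finite : sigma_finite setT (lebesgue_rVS m).
Proof.
have /sigma_finiteP[F [TF ndF Foo]] := sigma_finiteT (@lebesgue_measure R).
have /sigma_finiteP[G [TG ndG Goo]] := sigma_finiteT m.
exists (fun k => @vuncons d @^-1` (F k `*` G k)).
  rewrite -preimage_bigcup; apply/esym/seteqP; split=> // x _ /=.
  have : (\bigcup_i F i) (vuncons x).1 by rewrite -TF.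
  have : (\bigcup_i G i) (vuncons x).2 by rewrite -TG.
  move=> [j _ Gj] [k _ Fk]; exists (maxn j k) => //; split.
    by move: Fk; exact/subsetPset/ndF/leq_maxr.
  by move: Gj; exact/subsetPset/ndG/leq_maxl.
move=> k; have [mF Fk] := Foo k; have [mG Gk] := Goo k; split.
  rewrite -[X in measurable X]setTI; apply: measurable_vuncons => //.
  exact: measurableX.
rewrite /lebesgue_rVS /pushforward -comp_preimage.
rewrite (_ : @vuncons d \o @vcons d = id).
  by rewrite product_measure1E// lte_mul_pinfty// ge0_fin_numE.
by apply/funext => p /=; rewrite vconsK.
Qed.

HB.instance Definition _ := Measure_isSigmaFinite.Build _ _ _ (lebesgue_rVS m)
  lebesgue_rVS_sigma_finite.
End instances.

Fixpoint lebesgue_rV d : {sigma_finite_measure set 'rV[R]_d -> \bar R} :=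
  if d is d'.+1 then lebesgue_rVS (lebesgue_rV d')
  else dirac (0 : 'rV[R]_0).

End lebesgue_rV.
Arguments lebesgue_rV {R} d.

(* The norm of the library on 'rV[R]_d is the sup norm. *)
Definition enorm (R : realType) d (x : 'rV[R]_d) : R :=
  Num.sqrt (\sum_(i < d) x ord0 i ^+ 2).

Definition disc (R : realType) d (rho : R) : set 'rV[R]_d :=
  [set x | enorm x < rho].
Arguments disc {R} d rho.

Definition unit_cube (R : realType) d : set 'rV[R]_d :=
  [set x | forall i, 0 <= x ord0 i <= 1].
Arguments unit_cube : clear implicits.

Definition unit_ball_volume (R : realType) d : R :=
  fine (lebesgue_rV d (disc d (1 : R))).

Definition intensity (R : realType) d (lambda r : R) : R :=
  lambda / (unit_ball_volume R d * r ^+ d).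

Definition minkowski_sum (R : realType) d (A B : set 'rV[R]_d) : set 'rV[R]_d :=
  [set a + b | a in A & b in B].

Definition BadPairs (R : realType) d (r : R) (P : set 'rV[R]_d) :
  set (set 'rV[R]_d) :=
  [set [set z.1; z.2] | z in
    [set z | [/\ P z.1, P z.2, z.1 <> z.2 & enorm (z.1 - z.2) < 2 * r]]].

Definition BadPoints (R : realType) d (r : R) (P : set 'rV[R]_d) :
  set 'rV[R]_d := \bigcup_(e in BadPairs r P) e.

Definition resampling_region (R : realType) d (r : R) (P : set 'rV[R]_d) :
  set 'rV[R]_d :=
  minkowski_sum (BadPoints r P) (disc d (2 * r)) `&` unit_cube R d.

Definition npoints (R : realType) d (A P : set 'rV[R]_d) : nat :=
  #|` fset_set (P `&` A)|.

(* Unlike poisson_pmf, which is constantly 1 at parameter 0, this is the mass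
   function of the Poisson law for all a >= 0. *)
Definition poisson_mass (R : realType) (a : R) (n : nat) : R :=
  expR (- a) * a ^+ n / n`!%:R.

Definition random_finite_set (R : realType) d dO (Omega : measurableType dO)
    (X : Omega -> set 'rV[R]_d) : Prop :=
  (forall w, finite_set (X w)) /\
  forall A, measurable A ->
    measurable_fun [set: Omega] (fun w => npoints A (X w)).

Definition poisson_process (R : realType) d dO (Omega : measurableType dO)
    (Pr : probability Omega R) (c : R) (S : set 'rV[R]_d)
    (X : Omega -> set 'rV[R]_d) : Prop :=
  [/\ random_finite_set X,
      forall w, X w `<=` S &
      forall k (A : 'I_k -> set 'rV[R]_d) (n : 'I_k -> nat),
        (forall i, measurable (A i)) -> trivIset [set: 'I_k] A ->
        Pr [set w | forall i, npoints (A i) (X w) = n i] =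
        (\prod_(i < k)
           poisson_mass (c * fine (lebesgue_rV d (A i `&` S))) (n i))%:E].

(* Conditionally on the sigma-algebra H, X is a Poisson point process of
   intensity c on the H-measurable random region S: this is the definition
   above with the probability of the joint counts replaced by their conditional
   probability given H, characterized by its integrals over the events of H. *)
Definition poisson_process_given (R : realType) d dO (Omega : measurableType dO)
    (Pr : probability Omega R) (H : set (set Omega)) (c : R)
    (S X : Omega -> set 'rV[R]_d) : Prop :=
  [/\ random_finite_set X,
      forall w, X w `<=` S w &
      forall k (A : 'I_k -> set 'rV[R]_d) (n : 'I_k -> nat) (E : set Omega),
        (forall i, measurable (A i)) -> trivIset [set: 'I_k] A -> H E ->
        Pr (E `&` [set w | forall i, npoints (A i) (X w) = n i]) =
        (\int[Pr]_(w in E) (\prod_(i < k)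
           poisson_mass (c * fine (lebesgue_rV d (A i `&` S w))) (n i))%:E)%E].

(* The sigma-algebra generated by the point sets P 0, ..., P t.  In a run of the
   algorithm they determine the fresh samples drawn so far, namely
   Q s = P s.+1 `&` resampling_region r (P s) for s < t. *)
Definition history (R : realType) d (Omega : Type)
    (P : nat -> Omega -> set 'rV[R]_d) (t : nat) : set (set Omega) :=
  <<s [set E | exists s A n, [/\ (s <= t)%N, measurable A &
         E = [set w | npoints A (P s w) = n]]] >>.

(* P t is the point set after t iterations and Q t the fresh sample of iteration
   t.+1.  Nothing is said about halting: once BadPoints r (P t w) is empty, so is
   the region to resample, and the iteration is the identity. *)
Definition partial_rejection_sampling (R : realType) d
    dO (Omega : measurableType dO) (Pr : probability Omega R) (lambda r : R)
    (P Q : nat -> Omega -> set 'rV[R]_d) : Prop :=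
  [/\ poisson_process Pr (intensity d lambda r) (unit_cube R d) (P 0%N),
      forall t, poisson_process_given Pr (history P t) (intensity d lambda r)
        (fun w => resampling_region r (P t w)) (Q t) &
      forall t w, P t.+1 w = P t w `\` BadPoints r (P t w) `|` Q t w].

(* The index of the first P t without bad points, +oo if there is none. *)
Definition iterations (R : realType) d (Omega : Type) (r : R)
    (P : nat -> Omega -> set 'rV[R]_d) (w : Omega) : \bar R :=
  ereal_inf [set t%:R%:E | t in [set t | BadPoints r (P t w) = set0]].

(* Main.v *)
(* After t iterations, the point process P t has Papangelou intensity at most
   the Poisson intensity c: the sum of F (x, P t minus x) over x in P t has
   expectation at most the expected integral of c F (x, P t) over the cube.  For
   P 0 this is the Mecke formula, and it survives resampling because removing an
   isolated point x changes neither the bad points nor the resampled region,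
   while an isolated point never lies in that region.

   In P t.+1 every bad pair has a point in the region S resampled from P t.  Two
   applications of the bound show that the expected number of ordered bad pairs
   of P t.+1 is at most the expectation of the double integral of c ^ 2 over the
   pairs at distance less than 2r with a point in S, hence at most
   2 (c |D_2r|) |S| c.  As c |D_2r| <= 2 ^ d lambda and S is covered by the balls
   of radius 2r around the bad points, each step multiplies the expected number
   of ordered bad pairs by at most alpha = 2 (2 ^ d lambda) ^ 2 < 1.  It starts
   at O(r ^ -d), so it takes O(log (1 / r)) steps to bring it below a constant,
   after which the tail of the number of iterations is geometric. *)

Require Import Defs.
From HB Require Import structures.
From mathcomp Require Import all_boot all_order all_algebra finmap.
From mathcomp Require Import all_classical all_reals all_analysis.
From mathcomp Require Import measurable_realfun.
From mathcomp Require Import zify ring lra.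
Set Implicit Arguments.
Unset Strict Implicit.
Unset Printing Implicit Defensive.
Import Order.TTheory GRing.Theory Num.Theory.
Import numFieldNormedType.Exports.

Local Open Scope classical_set_scope.
Local Open Scope ring_scope.

(** The law of a fresh sample given the past is prescribed only through integrals over history
    events, so there is no kernel to integrate against. Identities between joint laws are therefore
    stated as equalities of positive functionals and checked on a pi-system whose events test the
    fresh sample by avoidance alone. There the Poisson hypothesis yields a void probability, a
    function of the past that may replace the avoidance indicator under the integral. Inequalities
    do not extend from a pi-system, so the bound on the kept points is first made an equality by
    Radon-Nikodym.

    Domination survives with the same constant because the intensities live on disjoint sets: c on
    the resampled region for fresh points, at most c on the points isolated from the old
    configuration, hence off that region, for kept ones.

    In alpha, the factor 2 is the choice of which point of a pair lies in S. One factor 2 ^ d lambda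
    is the mass of the ball around that point, the other the mass of each ball in the cover of S.

    Tail probabilities are avoided: the number of iterations is at most n plus the sum of the
    bad-pair counts from time n on. *)

Lemma measurable_preimage d1 d2 (T1 : measurableType d1) (T2 : measurableType d2)
  (f : T1 -> T2) (A : set T2) : measurable_fun setT f -> measurable A -> measurable (f @^-1` A).
Proof. by move=> mf mA; rewrite -[X in measurable X]setTI; exact: mf. Qed.

(** * Finite configurations of points *)

Section config.
Context {R : realType} {d : nat}.

(** A separate type of finite sets can carry its own sigma-algebra: a point process becomes a
    measurable map into it, and sums over its points are big sums. *)
Definition config : Type := {fset 'rV[R]_d}.
HB.instance Definition _ := Pointed.on config.

Definition avoids (A : set 'rV[R]_d) : set config :=
  [set eta : config | forall x, x \in eta -> ~ A x].

(* Avoidance events are closed under intersection and, as configurations are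
   finite sets, they already determine all counts (Renyi). *)
Definition avoid_events : set (set config) := [set avoids A | A in measurable].

HB.instance Definition _ := @isMeasurable.Build default_measure_display config
  <<s avoid_events >> (@sigma_algebra0 _ setT avoid_events)
  (@sigma_algebraC _ avoid_events) (@sigma_algebra_bigcup _ setT avoid_events).

Lemma measurable_avoids A : measurable A -> measurable (avoids A).
Proof. by move=> mA; apply: sub_sigma_algebra; exists A. Qed.

Definition card_in (A : set 'rV[R]_d) (eta : config) : nat :=
  count (fun x => x \in A) eta.

Lemma card_in_split A U eta :
  card_in A eta = (card_in (A `&` U) eta + card_in (A `\` U) eta)%N.
Proof.
rewrite /card_in; elim: (eta : seq _) => //= x s ->.
rewrite in_setI in_setD.
by case: (x \in A); case: (x \in U) => /=; lia.
Qed.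

Lemma card_in_gt0 A eta : (0 < card_in A eta)%N <-> ~ avoids A eta.
Proof.
rewrite -has_count; split.
  by move=> /hasP[x xe /set_mem Ax] /(_ x xe).
move=> /existsNP[x] /not_implyP[xe /contrapT Ax].
by apply/hasP; exists x => //; apply/mem_set.
Qed.

Definition half_space (i : 'I_d) (q : rat) : set 'rV[R]_d :=
  [set x | x ord0 i < ratr q].

Lemma measurable_half_space i q : measurable (half_space i q).
Proof.
rewrite -[X in measurable X]setTI.
have := measurable_coord i measurableT (measurable_itv `]-oo, (ratr q : R)[).
by rewrite (_ : _ @^-1` _ = half_space i q)//; apply/seteqP; split => x /=; rewrite in_itv.
Qed.

(* Two distinct points are separated by a rational half-space: by induction on k
   this expresses counts through avoidance events. *)
Lemma card_in_geP A k eta : (2 <= k)%N -> (k <= card_in A eta)%N <->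
  exists i q a, [/\ (0 < a < k)%N, (a <= card_in (A `&` half_space i q) eta)%N &
    (k - a <= card_in (A `\` half_space i q) eta)%N].
Proof.
move=> k2; split; last first.
  move=> [i [q [a [/andP[a0 ak] h1 h2]]]].
  by rewrite (card_in_split _ (half_space i q)); lia.
move=> kA.
have [x [y [xe ye [Ax Ay] xy]]] : exists x y, [/\ x \in eta, y \in eta, A x /\ A y & x != y].
  move: kA; rewrite /card_in -size_filter.
  have := filter_uniq (fun x => x \in A) (fset_uniq eta).
  have : all (fun x => (x \in eta) && (x \in A)) [seq x <- eta | x \in A].
    by apply/allP => x; rewrite mem_filter => /andP[-> ->].
  case: [seq x <- eta | x \in A] => [|x [|y s]] /=; [lia|lia|].
  move=> /and3P[/andP[xe /set_mem Ax] /andP[ye /set_mem Ay] _].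
  rewrite inE negb_or => /andP[/andP[xy _] _] _.
  by exists x, y.
have [i xyi] : exists i, x ord0 i != y ord0 i.
  apply/existsP; rewrite -negb_forall; apply: contra xy => /forallP h.
  by apply/eqP/rowP => i; apply/eqP.
wlog : x y xe ye Ax Ay xy xyi / x ord0 i < y ord0 i.
  move=> h; case: (ltgtP (x ord0 i) (y ord0 i)) xyi => // xyi _.
    by apply: (h x y) => //; rewrite lt_eqF.
  by apply: (h y x) => //; [rewrite eq_sym|rewrite lt_eqF].
move=> /rat_in_itvoo[q]; rewrite in_itv/= => /andP[xq qy].
(* Both halves contain a point of [eta] in [A], namely x and y. Capping the first count at k - 1
   keeps it below k and leaves at least one point to ask of the other half. *)
exists i, q, (minn (card_in (A `&` half_space i q) eta) k.-1).
have h1 : (0 < card_in (A `&` half_space i q) eta)%N.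
  by apply/card_in_gt0 => /(_ x xe); apply; split.
have h2 : (0 < card_in (A `\` half_space i q) eta)%N.
  apply/card_in_gt0 => /(_ y ye); apply; split => //.
  by rewrite /half_space/= ltNge (ltW qy).
have := card_in_split A (half_space i q) eta.
by move: (card_in _ _) kA h1 h2 => u; split; lia.
Qed.

Lemma measurable_card_in_ge A k : measurable A ->
  measurable [set eta : config | (k <= card_in A eta)%N].
Proof.
(* Strong induction on k: from k = 2 on, each half-space split asks both parts for at least one and
   fewer than k points, and there are countably many splits. *)
have [n] := ubnP k; elim: n k A => // n IH [|[|k]] A kn mA.
- by rewrite (_ : [set _ | _] = setT)//; apply/seteqP; split.
- rewrite (_ : [set _ | _] = ~` avoids A); first by apply: measurableC; exact: measurable_avoids.
  by apply/seteqP; split => eta; rewrite /= card_in_gt0.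
- rewrite (_ : [set _ | _] = \bigcup_i \bigcup_q \bigcup_(a in `I_k.+2)
     if (0 < a)%N then
      [set eta : config | (a <= card_in (A `&` half_space i q) eta)%N] `&`
      [set eta : config | (k.+2 - a <= card_in (A `\` half_space i q) eta)%N] else set0).
    apply: fin_bigcup_measurable => // i _.
    apply: bigcupT_measurable_rat => q.
    apply: bigcup_measurable => a /= ak; case: ifPn => // a0.
    have mH := measurable_half_space i q.
    apply: measurableI; apply: IH; try lia.
      exact: measurableI.
    exact: measurableD.
  apply/seteqP; split => eta /=.
    move=> /card_in_geP[]// i [q [a [/andP[a0 ak] h1 h2]]].
    by exists i => //; exists q => //; exists a => //; rewrite a0.
  move=> [i _ [q _ [a /= ak]]]; case: ifPn => // a0 [/= h1 h2].
  by apply/card_in_geP => //; exists i, q, a; rewrite a0 ak.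
Qed.

Lemma measurable_card_in A n : measurable A ->
  measurable [set eta : config | card_in A eta = n].
Proof.
move=> mA; rewrite (_ : [set _ | _] = [set eta : config | (n <= card_in A eta)%N] `\`
   [set eta : config | (n.+1 <= card_in A eta)%N]).
  by apply: measurableD; exact: measurable_card_in_ge.
apply/seteqP; split => eta /=; first by move=> ->; split => //; lia.
by case; lia.
Qed.

End config.
Arguments config : clear implicits.

(** * Integral functionals *)

Section nonneg_measurable.
Local Open Scope ereal_scope.
Context {R : realType} d {T : measurableType d}.
Implicit Types f g : T -> \bar R.

Definition nnmf f := (forall x, 0 <= f x) /\ measurable_fun [set: T] f.

Lemma nnmf_ge0 f : nnmf f -> forall x, 0 <= f x. Proof. by case. Qed.
Lemma nnmf_mfun f : nnmf f -> measurable_fun setT f. Proof. by case. Qed.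

Lemma nnmfD f g : nnmf f -> nnmf g -> nnmf (fun x => f x + g x).
Proof.
move=> [f0 mf] [g0 mg]; split; first by move=> x; rewrite adde_ge0.
exact: emeasurable_funD.
Qed.

Lemma nnmfM f g : nnmf f -> nnmf g -> nnmf (fun x => f x * g x).
Proof.
move=> [f0 mf] [g0 mg]; split; first by move=> x; rewrite mule_ge0.
exact: emeasurable_funM.
Qed.

Lemma nnmf_cst (k : \bar R) : 0 <= k -> nnmf (fun=> k).
Proof. by move=> k0; split. Qed.

Lemma nnmfZ (k : \bar R) f : 0 <= k -> nnmf f -> nnmf (fun x => k * f x).
Proof. by move=> k0 nf; apply: nnmfM => //; exact: nnmf_cst. Qed.

Lemma nnmf_sum I (s : seq I) (f : I -> T -> \bar R) :
  (forall i, nnmf (f i)) -> nnmf (fun x => \sum_(i <- s) f i x).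
Proof.
move=> nf; split; first by move=> x; rewrite sume_ge0// => i _; apply: nnmf_ge0.
by apply: emeasurable_sum => i; apply: nnmf_mfun.
Qed.

Lemma nnmf_indic A : measurable A -> nnmf (fun x => (\1_A x)%:E : \bar R).
Proof.
move=> mA; split; first by move=> x; rewrite lee_fin.
by apply/measurable_EFinP; exact: measurable_indic.
Qed.

End nonneg_measurable.

Lemma nnmf_comp (R : realType) d (T : measurableType d) d' (T' : measurableType d')
    (f : T -> \bar R) (g : T' -> T) :
  nnmf f -> measurable_fun setT g -> nnmf (fun x => f (g x)).
Proof. by move=> [f0 mf] mg; split; [move=> x|exact: measurableT_comp]. Qed.

Section generic_lemmas.
Local Open Scope ereal_scope.
Context {R : realType}.

Lemma nnmf_pair1 d1 d2 (T1 : measurableType d1) (T2 : measurableType d2) (f : T1 * T2 -> \bar R) t :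
  nnmf f -> nnmf (fun x => f (t, x)).
Proof. by move=> nf; apply: (nnmf_comp nf); exact: measurable_pair1. Qed.

Lemma nnmf_integralD d' (T : measurableType d') (m : {measure set T -> \bar R}) f g :
  nnmf f -> nnmf g -> \int[m]_x (f x + g x) = \int[m]_x f x + \int[m]_x g x.
Proof. by move=> [f0 mf] [g0 mg]; rewrite ge0_integralD. Qed.

Lemma nnmf_integralZ d' (T : measurableType d') (m : {measure set T -> \bar R})
   (f : T -> \bar R) k :
  nnmf f -> 0 <= k -> \int[m]_x (k * f x) = k * \int[m]_x f x.
Proof. by move=> [f0 mf] k0; rewrite ge0_integralZl. Qed.

Lemma le_nnmf_integral d' (T : measurableType d') (m : {measure set T -> \bar R})
   (f g : T -> \bar R) :
  nnmf f -> nnmf g -> (forall x, f x <= g x) -> \int[m]_x f x <= \int[m]_x g x.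
Proof. by move=> [f0 mf] [g0 mg] fg; apply: ge0_le_integral. Qed.

(** The integral of a nonnegative function is a supremum over the simple functions below it, which
    is monotone without measurability. This serves to bound the integral of [iterations]
    directly. *)
Lemma ge0_le_integral_nonmeasurable d (T : measurableType d)
  (m : {measure set T -> \bar R}) (f g : T -> \bar R) :
  (forall w, 0 <= f w)%E -> (forall w, f w <= g w)%E ->
  (\int[m]_w f w <= \int[m]_w g w)%E.
Proof.
move=> f0 fg; rewrite !ge0_integralTE//; last by move=> w; exact: le_trans (f0 w) (fg w).
apply: le_ereal_sup => _ [h hf <-].
by exists h => // w; exact: le_trans (hf w) (fg w).
Qed.

Lemma le_sum_seq (T : eqType) (s : seq T) (f f' : T -> \bar R) :
  (forall x, x \in s -> f x <= f' x) -> \sum_(x <- s) f x <= \sum_(x <- s) f' x.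
Proof. by move=> h; rewrite big_seq [leRHS]big_seq; apply: lee_sum => x; exact: h. Qed.

Lemma le_sum_mem (T : eqType) (s : seq T) (f : T -> \bar R) x :
  (forall x, 0 <= f x) -> x \in s -> f x <= \sum_(x <- s) f x.
Proof.
move=> f0 xs; rewrite (big_rem x)//= leeDl//.
by apply: sume_ge0 => y _.
Qed.

End generic_lemmas.

Section integral_functional.
Local Open Scope ereal_scope.
Context {R : realType} d {T : measurableType d}.
Implicit Types f g : T -> \bar R.

(* Iterated and weighted integrals are compared as functionals, which avoids
   naming the measures they define. *)
Record integral_functional (Phi : (T -> \bar R) -> \bar R) : Prop := {
  functional_ge0 : forall f, nnmf f -> 0 <= Phi f ;
  functional_le : forall f g, nnmf f -> nnmf g -> (forall x, f x <= g x) ->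
    Phi f <= Phi g ;
  functionalD : forall f g, nnmf f -> nnmf g ->
    Phi (fun x => f x + g x) = Phi f + Phi g ;
  functionalZ : forall (k : R) f, (0 <= k)%R -> nnmf f ->
    Phi (fun x => k%:E * f x) = k%:E * Phi f ;
  functional_lim : forall f : nat -> T -> \bar R, (forall n, nnmf (f n)) ->
    (forall x, nondecreasing_seq (f ^~ x)) ->
    Phi (fun x => limn (f ^~ x)) = limn (fun n => Phi (f n)) }.

Lemma functional0 Phi : integral_functional Phi -> Phi (fun=> 0) = 0.
Proof.
move=> iP; have h := functionalZ iP (lexx 0%R) (nnmf_cst (lexx 0%E)).
transitivity (Phi (fun x => 0%:E * 0)).
  by congr (Phi _); apply/funext => x; rewrite mule0.
by rewrite h mul0e.
Qed.

Lemma functional_sum Phi I (s : seq I) (f : I -> T -> \bar R) :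
  integral_functional Phi -> (forall i, nnmf (f i)) ->
  Phi (fun x => \sum_(i <- s) f i x) = \sum_(i <- s) Phi (f i).
Proof.
move=> iP nf; elim: s => [|i s IH].
  rewrite big_nil -[RHS](functional0 iP); congr (Phi _).
  by apply/funext => x; rewrite big_nil.
rewrite big_cons -IH -functionalD//; last exact: nnmf_sum.
by congr Phi; apply/funext => x; rewrite big_cons.
Qed.

Lemma nd_sum_nnmf (f : nat -> T -> \bar R) (nf : forall i, nnmf (f i)) x :
  nondecreasing_seq (fun n => \sum_(0 <= i < n) f i x).
Proof.
apply/nondecreasing_seqP => n; rewrite big_nat_recr//= leeDl//.
exact: nnmf_ge0.
Qed.

Section measure_of.
Variables (Phi : (T -> \bar R) -> \bar R) (iP : integral_functional Phi).


(* 0 off the measurable sets, because a measure is nonnegative on all sets *)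
Let mu (A : set T) : \bar R :=
  if pselect (measurable A) then Phi (fun x => (\1_A x)%:E) else 0.

Let muE A : measurable A -> mu A = Phi (fun x => (\1_A x)%:E).
Proof. by rewrite /mu; case: pselect. Qed.

Let mu0 : mu set0 = 0.
Proof.
rewrite muE// -[RHS](functional0 iP); congr (Phi _).
by apply/funext => x; rewrite indic0.
Qed.

Let mu_ge0 A : 0 <= mu A.
Proof.
rewrite /mu; case: pselect => // mA; apply: (functional_ge0 iP).
exact: nnmf_indic.
Qed.

Let mu_sigma : semi_sigma_additive mu.
Proof.
move=> F mF tF mUF.
pose f n x : \bar R := \sum_(0 <= i < n) (\1_(F i) x)%:E.
have nf n : nnmf (f n) by apply: nnmf_sum => i; exact: nnmf_indic.
have ndf x : nondecreasing_seq (f ^~ x).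
  by apply: (@nd_sum_nnmf (fun i x => (\1_(F i) x)%:E)) => i; exact: nnmf_indic.
rewrite [X in X @ _ --> _](_ : _ = (fun n => Phi (f n))); last first.
  apply/funext => n; rewrite /f functional_sum//; last by move=> i; exact: nnmf_indic.
  by apply: eq_bigr => i _; rewrite muE.
rewrite muE//.
have -> : (fun x => (\1_(\bigcup_n F n) x)%:E) = (fun x => limn (f ^~ x)) :> (T -> \bar R).
  by apply/funext => x; rewrite indic_bigcup.
rewrite (functional_lim iP)//; apply: ereal_nondecreasing_is_cvgn => m n mn.
by apply: (functional_le iP) => // x; exact: ndf.
Qed.

Import HBNNSimple.

(** A Daniell-type representation. The values on indicators form a measure, sigma-additive because
    [functional_lim] applies to partial sums of indicators. Linearity gives agreement on simple
    functions, and monotone approximation on the rest. *)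
Lemma functional_measure : exists m : {measure set T -> \bar R},
  forall f, nnmf f -> \int[m]_x f x = Phi f.
Proof.
pose mm := isMeasure.Build _ _ _ mu mu0 mu_ge0 mu_sigma.
pose m : {measure set T -> \bar R} := HB.pack mu mm.
have mS (g : {nnsfun T >-> R}) : \int[m]_x (g x)%:E = Phi (fun x => (g x)%:E).
  rewrite integralT_nnsfun sintegralE fsbig_finite//=.
  have nr r : nnmf (fun x => (r * \1_(g @^-1` [set r]) x)%:E).
    split; first by move=> x; exact: nnfun_muleindic_ge0.
    apply/measurable_EFinP/measurable_funM => //.
  have -> : (fun x => (g x)%:E) =
      (fun x => \sum_(r <- fset_set (range g)) (r * \1_(g @^-1` [set r]) x)%:E).
    by apply/funext => x; rewrite fimfunE fsbig_finite//= sumEFin.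
  rewrite functional_sum//; rewrite big_seq [RHS]big_seq; apply: eq_bigr => r.
  rewrite in_fset_set// inE/= => -[x _ <-{r}].
  under eq_fun do rewrite EFinM.
  by rewrite (functionalZ iP)// ?muE//; exact: nnmf_indic.
exists m => f nf; have [f0 mf] := nf.
pose g := nnsfun_approx measurableT mf.
have -> : f = (fun x => limn (EFin \o g ^~ x)).
  by apply/funext => x; apply/esym/cvg_lim => //; exact: cvg_nnsfun_approx.
have ng n : nnmf (EFin \o g n).
  split; first by move=> x; rewrite lee_fin.
  exact/measurable_EFinP.
have ndg x : nondecreasing_seq (fun n => EFin (g n x)).
  by move=> i j ij; rewrite lee_fin; exact/lefP/nd_nnsfun_approx.
have lg := @functional_lim _ iP (fun n => EFin \o g n) ng ndg.
rewrite lg (@monotone_convergence _ _ _ m _ measurableT (fun n => EFin \o g n))//.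
- by congr (limn _); apply/funext => n; exact: mS.
- by move=> n; apply: nnmf_mfun.
- by move=> n x _; apply: nnmf_ge0.
- by move=> x _; exact: ndg.
Qed.

End measure_of.

(** Uniqueness of finite measures on a generating pi-system, transported through
    [functional_measure]. As [G] contains the whole space, the constant sequence [setT] is the
    exhaustion required. *)
Lemma functional_ext (G : set (set T)) Phi Psi :
  integral_functional Phi -> integral_functional Psi ->
  measurable = <<s G >> -> setI_closed G -> G setT ->
  Phi (fun=> 1) < +oo ->
  (forall A, G A -> Phi (fun x => (\1_A x)%:E) = Psi (fun x => (\1_A x)%:E)) ->
  forall f, nnmf f -> Phi f = Psi f.
Proof.
move=> iP iQ mG GI GT Poo PQ f nf.
have [m1 m1E] := functional_measure iP; have [m2 m2E] := functional_measure iQ.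
rewrite -m1E// -m2E//; apply: eq_measure_integral => A mA _.
have mGA B : G B -> measurable B by rewrite mG; exact: sub_sigma_algebra.
apply: (@measure_unique _ _ _ G (fun=> setT)) => //.
- by rewrite bigcup_const.
- move=> B GB; rewrite -(setIT B) -!integral_indic//; try exact: mGA.
  by rewrite m1E ?m2E ?PQ//; apply: nnmf_indic; exact: mGA.
- move=> _; have := m1E _ (nnmf_indic measurableT); rewrite integral_indic// setIT => ->.
  by rewrite indicT.
Qed.

(** Radon-Nikodym for the two representing measures, which are finite since [Psi] is finite at 1 and
    dominates [Phi]. *)
Lemma functional_density Phi Psi :
  integral_functional Phi -> integral_functional Psi ->
  Psi (fun=> 1) < +oo -> (forall f, nnmf f -> Phi f <= Psi f) ->
  exists h : T -> \bar R, [/\ nnmf h, forall x, h x <= 1 &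
    forall f, nnmf f -> Phi f = Psi (fun x => f x * h x)].
Proof.
move=> iP iQ Qoo PQ.
have [m1 m1E] := functional_measure iP; have [m2 m2E] := functional_measure iQ.
have m12 A : measurable A -> m1 A <= m2 A.
  move=> mA; rewrite -(setIT A) -!integral_indic// m1E ?m2E; try exact: nnmf_indic.
  by apply: PQ; exact: nnmf_indic.
have m2T : m2 setT < +oo.
  have := m2E _ (nnmf_indic measurableT); rewrite integral_indic// setIT => ->.
  by rewrite indicT.
have m1T : m1 setT < +oo by rewrite (le_lt_trans _ m2T)// m12.
have m0 (m : {measure set T -> \bar R}) : m set0 < +oo by rewrite measure0.
pose fn1 := lty_fin_num_fun m1T.
have sf1 := fin_num_fun_sigma_finite (m0 m1) fn1.
pose n1 := HB.pack_for (FiniteMeasure.type T R) (Measure.sort m1)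
  (isFinite.Build _ _ _ _ fn1) (isSFinite.Build _ _ _ _ (sfinite_measure_sigma_finite sf1))
  (isSigmaFinite.Build _ _ _ _ sf1).
pose fn2 := lty_fin_num_fun m2T.
have sf2 := fin_num_fun_sigma_finite (m0 m2) fn2.
pose n2 := HB.pack_for (FiniteMeasure.type T R) (Measure.sort m2)
  (isFinite.Build _ _ _ _ fn2) (isSFinite.Build _ _ _ _ (sfinite_measure_sigma_finite sf2))
  (isSigmaFinite.Build _ _ _ _ sf2).
have dom : n1 `<< n2.
  apply/null_content_dominatesP => A mA m2A; apply/eqP.
  by rewrite eq_le measure_ge0 andbT -[leRHS]m2A; exact: m12.
pose f := Radon_Nikodym_SigmaFinite.f n1 n2.
have f0 := Radon_Nikodym_SigmaFinite.f_ge0 dom.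
have mf := measurable_int _ (Radon_Nikodym_SigmaFinite.f_integrable dom).
have mA : measurable [set x | 1 < f x].
  by rewrite -[X in measurable X]setTI; exact: emeasurable_fun_o_infty.
(* The derivative is at most 1 only almost everywhere; truncation makes the bound hold everywhere
   and changes no integral. *)
pose h x := mine (f x) 1.
have nh : nnmf h.
  split; first by move=> x; rewrite le_min f0 lee_fin ler01.
  exact: measurable_mine.
exists h; split => //; first by move=> x; rewrite ge_min lexx orbT.
move=> g ng; rewrite -m1E// -m2E; last exact: nnmfM.
have -> : \int[m1]_x g x = \int[n1]_x g x by [].
have -> : \int[m2]_x (g x * h x) = \int[n2]_x (g x * h x) by [].
rewrite -(Radon_Nikodym_SigmaFinite.change_of_variables dom)//; last 2 first.
  by move=> x; apply: nnmf_ge0.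
  exact: nnmf_mfun.
pose A := [set x | 1 < f x].
(* On A, where f > 1, the inequality [m1 A <= m2 A] reads [m2 A] plus the integral of f - 1 is at
   most [m2 A]; so this nonnegative integral vanishes and A is a null set. *)
have f1A0 : \int[n2]_(x in A) (f x - 1) = 0.
  have e : \int[n2]_(x in A) f x = n2 A + \int[n2]_(x in A) (f x - 1).
    rewrite -[X in X + _](mul1e (n2 A)) -integral_cst// -ge0_integralD//.
    - by apply: eq_integral => x /set_mem Ax; rewrite addeC subeK.
    - by move=> x /ltW Ax; rewrite sube_ge0.
    - by apply: emeasurable_funB => //; exact: measurable_funTS.
  have : n1 A <= n2 A by exact: m12.
  rewrite (Radon_Nikodym_SigmaFinite.f_integral dom)// -/f e.
  rewrite -[leRHS]adde0 leeD2lE//; last exact: fin_num_measure.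
  move=> h0; apply/eqP; rewrite eq_le; apply/andP; split=> //.
  by apply: integral_ge0 => x /ltW Ax; rewrite sube_ge0.
have A0 : ae_eq n2 A (fun x => f x - 1) (cst 0).
  apply/ae_eq_integral_abs => //.
    by apply: emeasurable_funB => //; exact: measurable_funTS.
  rewrite -[RHS]f1A0; apply: eq_integral => x /set_mem /ltW fx.
  have f10 : 0 <= f x - 1 by rewrite sube_ge0.
  by rewrite gee0_abs.
apply: ge0_ae_eq_integral => //.
- by apply: emeasurable_funM => //; exact: nnmf_mfun.
- by apply: emeasurable_funM; exact: nnmf_mfun.
- by move=> x _; rewrite mule_ge0//; exact: nnmf_ge0.
- by move=> x _; rewrite mule_ge0//; exact: nnmf_ge0.
apply: filterS A0 => x Ax _; congr (_ * _).
rewrite /h; case: (leP (f x) 1) => [//|fx].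
have : 0 < f x - 1 by rewrite sube_gt0.
by rewrite (Ax fx) ltxx.
Qed.

End integral_functional.

Section functionals.
Local Open Scope ereal_scope.
Context {R : realType}.

Lemma limnZl (k : \bar R) (u : nat -> \bar R) : k \is a fin_num ->
  nondecreasing_seq u -> k * limn u = limn (fun n => k * u n).
Proof.
move=> kf ndu; apply/esym/cvg_lim => //; apply: cvgeZl => //.
exact: ereal_nondecreasing_is_cvgn.
Qed.

(** Finiteness of the weight [u] is what allows it to be moved inside increasing limits, by
    [limnZl]. *)
Lemma integral_functional_integral d (T : measurableType d) d' (T' : measurableType d')
    (m : {measure set T' -> \bar R}) (u : T' -> \bar R) (phi : T' -> T) :
  nnmf u -> (forall w, u w \is a fin_num) -> measurable_fun setT phi ->
  integral_functional (fun f : T -> \bar R => \int[m]_w (u w * f (phi w))).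
Proof.
move=> nu fu mphi.
have nuf f : nnmf f -> nnmf (fun w => u w * f (phi w)).
  by move=> nf; apply: nnmfM => //; exact: (nnmf_comp nf mphi).
split.
- by move=> f nf; apply: integral_ge0 => w _; exact: (nnmf_ge0 (nuf _ nf)).
- move=> f g nf ng fg; apply: ge0_le_integral => //.
  + by move=> x _; exact: (nnmf_ge0 (nuf _ nf)).
  + exact: (nnmf_mfun (nuf _ nf)).
  + exact: (nnmf_mfun (nuf _ ng)).
  + by move=> x _; rewrite lee_wpmul2l//; exact: nnmf_ge0.
- move=> f g nf ng; rewrite -ge0_integralD//.
  + by apply: eq_integral => w _; rewrite ge0_muleDr//; exact: nnmf_ge0.
  + by move=> x _; exact: (nnmf_ge0 (nuf _ nf)).
  + exact: (nnmf_mfun (nuf _ nf)).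
  + by move=> x _; exact: (nnmf_ge0 (nuf _ ng)).
  + exact: (nnmf_mfun (nuf _ ng)).
- move=> k f k0 nf; rewrite -ge0_integralZl//.
  + by apply: eq_integral => w _; rewrite muleCA.
  + exact: (nnmf_mfun (nuf _ nf)).
  + by move=> x _; exact: (nnmf_ge0 (nuf _ nf)).
- move=> f nf ndf; rewrite -(@monotone_convergence _ _ _ m _ measurableT)//.
  + by apply: eq_integral => w _; rewrite limnZl.
  + by move=> n; exact: (nnmf_mfun (nuf _ (nf n))).
  + by move=> n x _; exact: (nnmf_ge0 (nuf _ (nf n))).
  + by move=> x _ a b ab; rewrite lee_wpmul2l//; [exact: nnmf_ge0|exact: ndf].
Qed.

Lemma integral_functional_comp d (T : measurableType d) d' (T' : measurableType d')
    (Phi : (T' -> \bar R) -> \bar R) (L : (T -> \bar R) -> T' -> \bar R) :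
  integral_functional Phi -> (forall w, integral_functional (L ^~ w)) ->
  (forall f, nnmf f -> nnmf (L f)) ->
  integral_functional (fun f => Phi (L f)).
Proof.
move=> iP iL nL; split.
- by move=> f nf; apply: (functional_ge0 iP); exact: nL.
- move=> f g nf ng fg; apply: (functional_le iP); try exact: nL.
  by move=> w; apply: (functional_le (iL w)).
- move=> f g nf ng; rewrite -(functionalD iP)//; try exact: nL.
  by congr (Phi _); apply/funext => w; rewrite (functionalD (iL w)).
- move=> k f k0 nf; rewrite -(functionalZ iP)//; try exact: nL.
  by congr (Phi _); apply/funext => w; rewrite (functionalZ (iL w)).
- move=> f nf ndf; rewrite -(functional_lim iP); last 2 first.
  + by move=> n; exact: nL.
  + by move=> w a b ab; apply: (functional_le (iL w)) => // x; exact: ndf.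
  by congr (Phi _); apply/funext => w; rewrite (functional_lim (iL w)).
Qed.

(** Exactly what iterated integrals need from a parametrised measure. It covers both families in
    use, the constant Lebesgue measure and the counting measures of random configurations. *)
Definition measurable_family d (T : measurableType d) d' (X : measurableType d')
    (k : T -> {measure set X -> \bar R}) : Prop :=
  forall f : T * X -> \bar R, nnmf f ->
    measurable_fun setT (fun w => \int[k w]_x f (w, x)).

Lemma nnmf_family d (T : measurableType d) d' (X : measurableType d')
    (k : T -> {measure set X -> \bar R}) (f : T * X -> \bar R) :
  measurable_family k -> nnmf f -> nnmf (fun w => \int[k w]_x f (w, x)).
Proof.
move=> mk nf; split; last exact: mk.
by move=> w; apply: integral_ge0 => x _; exact: nnmf_ge0.
Qed.

Lemma measurable_family_cst d (T : measurableType d) d' (X : measurableType d')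
    (m : {sigma_finite_measure set X -> \bar R}) :
  measurable_family (fun _ : T => m).
Proof.
by move=> f [f0 mf]; exact: (measurable_fun_fubini_tonelli_F f mf f0).
Qed.

Lemma integral_functional_iter d (T : measurableType d) d' (W : measurableType d')
    d'' (X : measurableType d'') (m : {measure set W -> \bar R})
    (k : W -> {measure set X -> \bar R}) (u : W * X -> \bar R) (phi : W * X -> T) :
  measurable_family k ->
  nnmf u -> (forall w, u w \is a fin_num) -> measurable_fun setT phi ->
  integral_functional (fun f : T -> \bar R =>
    \int[m]_w \int[k w]_x (u (w, x) * f (phi (w, x)))).
Proof.
move=> mk nu fu mphi.
have i1 : integral_functional (fun f : W -> \bar R => \int[m]_w f w).
  have := @integral_functional_integral _ _ _ _ m (fun=> 1) id (nnmf_cst lee01)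
    (fun=> isT) (@measurable_id _ _ _).
  by congr integral_functional; apply/funext => f; apply: eq_integral => w _; rewrite mul1e.
apply: (@integral_functional_comp _ _ _ _ _
  (fun (f : T -> \bar R) w => \int[k w]_x (u (w, x) * f (phi (w, x)))) i1).
  move=> w; apply: integral_functional_integral => //.
    by apply: (nnmf_comp nu); exact: measurable_pair1.
  by apply: (measurableT_comp mphi); exact: measurable_pair1.
move=> f nf; apply: (@nnmf_family _ _ _ _ k (fun p => u p * f (phi p))) => //.
by apply: nnmfM => //; exact: (nnmf_comp nf mphi).
Qed.

End functionals.

(** * Sums over the points of a configuration as integrals *)

Section point_measure.
Local Open Scope ereal_scope.
Context {R : realType} {d : nat}.
Notation X := 'rV[R]_d.

Definition point_measure (eta : config R d) : {measure set X -> \bar R} :=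
  msum (fun i => \d_(nth 0%R (eta : seq X) i)) (size (eta : seq X)).

Lemma point_measureE eta (A : set X) :
  point_measure eta A = (card_in A eta)%:R%:E.
Proof.
transitivity (\sum_(x <- (eta : seq X)) \d_x A : \bar R).
  by rewrite (big_nth 0%R) big_mkord.
rewrite /card_in; elim: (eta : seq X) => [|x s IH]; first by rewrite big_nil.
by rewrite big_cons IH /= diracE natrD EFinD.
Qed.

Lemma integral_point_measure eta (f : X -> \bar R) : nnmf f ->
  \int[point_measure eta]_x f x = \sum_(x <- eta) f x.
Proof.
move=> [f0 mf]; rewrite ge0_integral_measure_sum//.
rewrite (big_nth 0%R) big_mkord; apply: eq_bigr => i _.
by rewrite integral_dirac// diracT mul1e.
Qed.

Import HBNNSimple.

(** Simple approximation reduces the claim to sections of measurable sets of the product, and a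
    lambda-system argument reduces those to rectangles, where the value is a count times an
    indicator. Proper differences cause no trouble because counts are finite. *)
Lemma measurable_family_point d' (T : measurableType d') (Q : T -> config R d) :
  measurable_fun setT Q -> measurable_family (fun w => point_measure (Q w)).
Proof.
move=> mQ f [f0 mf].
pose f_ := nnsfun_approx measurableT mf.
apply: (@measurable_fun_xsection_integral _ _ _ _ _ _ _ f_).
- by move=> a b ab; exact/nd_nnsfun_approx.
- by move=> z; exact/cvg_nnsfun_approx.
move=> n r.
pose phi (A : set (T * X)) w := point_measure (Q w) (xsection A w).
pose XY := [set A | measurable A /\ measurable_fun [set: T] (phi A)].
suff : measurable `<=` XY.
  move=> sub; have mA : measurable ((f_ n : T * X -> R) @^-1` [set r]).
    by rewrite -[X in measurable X]setTI; apply: measurable_funP.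
  by have [] := sub _ mA.
rewrite measurable_prod_measurableType.
set C := [set A `*` B | A in measurable & B in measurable].
have CI : setI_closed C.
  move=> _ _ [X1 mX1 [X2 mX2 <-]] [Y1 mY1 [Y2 mY2 <-]].
  exists (X1 `&` Y1); first exact: measurableI.
  by exists (X2 `&` Y2); [exact: measurableI|rewrite setXI].
have CT : C setT by exists setT => //; exists setT => //; rewrite setXTT.
have CXY : C `<=` XY.
  move=> _ [A mA [B mB <-]]; split; first exact: measurableX.
  have -> : phi (A `*` B) = (fun w => (card_in B (Q w))%:R%:E * (\1_A w)%:E).
    apply/funext => w; rewrite /phi/= indicE.
    have [wA|wA] := boolP (w \in A); first by rewrite mule1 in_xsectionX// point_measureE.
    by rewrite mule0 notin_xsectionX// measure0.
  apply: emeasurable_funM; last first.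
    by apply/measurable_EFinP; exact: measurable_indic.
  apply/measurable_EFinP; apply: (@measurableT_comp _ _ _ _ _ _ (fun n : nat => n%:R : R)) => //.
  move=> _ Y _; rewrite setTI.
  rewrite (_ : _ @^-1` _ = \bigcup_(n in Y) (Q @^-1` [set eta | card_in B eta = n])).
    apply: bigcup_measurable => k _; rewrite -[X in measurable X]setTI; apply: mQ => //.
    exact: measurable_card_in.
  by apply/seteqP; split => [w Yw|w [k Yk /= wk]]; [exists (card_in B (Q w))|rewrite /= wk].
suff lsystemB : lambda_system setT XY by exact: lambda_system_subset.
split => //; [exact: CXY| |exact: xsection_ndseq_closed].
move=> A B BA [mA mphiA] [mB mphiB]; split; first exact: measurableD.
suff : phi (A `\` B) = (fun x => phi A x - phi B x).
  by move=> ->; exact: emeasurable_funB.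
apply/funext => w; rewrite /phi/= xsectionD// measureD.
- by rewrite setIidr//; exact: le_xsection.
- exact: measurable_xsection.
- exact: measurable_xsection.
- by rewrite [X in X < _](point_measureE (Q w) (xsection A w)) ltry.
Qed.

End point_measure.

(** * Lebesgue measure of balls *)

Section euclidean.
Context {R : realType}.

Lemma measurable_enorm d d' (T : measurableType d') (f : T -> 'rV[R]_d) :
  measurable_fun setT f -> measurable_fun setT (fun t => enorm (f t)).
Proof.
move=> mf; have mfi i : measurable_fun setT (fun t => f t ord0 i).
  exact: (measurableT_comp (measurable_coord i) mf).
rewrite /enorm; apply: measurableT_comp.
  by apply: continuous_measurable_fun; exact: sqrt_continuous.
by apply: measurable_sum => i; exact: measurable_funX.
Qed.

Lemma measurable_rV_sub d d' (T : measurableType d') (f g : T -> 'rV[R]_d) :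
  measurable_fun setT f -> measurable_fun setT g ->
  measurable_fun setT (fun t => f t - g t).
Proof.
move=> /measurable_fun_rVP mf /measurable_fun_rVP mg.
apply/measurable_fun_rVP => i; under eq_fun do rewrite mxE mxE.
exact: measurable_funB.
Qed.

Lemma enorm_distC d (x y : 'rV[R]_d) : enorm (x - y) = enorm (y - x).
Proof.
rewrite /enorm; congr Num.sqrt; apply: eq_bigr => i _.
by rewrite !mxE -sqrrN opprB.
Qed.

Lemma measurable_cube d : measurable (unit_cube R d).
Proof.
rewrite (_ : unit_cube R d = \bigcap_(i in setT) ((fun x : 'rV[R]_d => x ord0 i) @^-1` `[0, 1])).
  apply: fin_bigcap_measurable => // i _.
  rewrite -[X in measurable X]setTI; apply: measurable_coord => //.
by apply/seteqP; split => x /= h i => [_|]; have := h i; rewrite /= in_itv//=; apply.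
Qed.

(** The inverse of the map y -> b + rho y, so that the preimage of a set is its scaled translate;
    for the unit disc it is the ball of radius rho around b. *)
Definition affine d (rho : R) (b y : 'rV[R]_d) : 'rV[R]_d := rho^-1 *: (y - b).

Lemma affineE d rho (b y : 'rV[R]_d) i :
  affine rho b y ord0 i = rho^-1 * (y ord0 i - b ord0 i).
Proof. by rewrite /affine !mxE. Qed.

Lemma measurable_affine d rho b : measurable_fun setT (@affine d rho b).
Proof.
apply/measurable_fun_rVP => i; under eq_fun do rewrite affineE.
apply: measurable_funM => //; apply: measurable_funB => //.
exact: measurable_coord.
Qed.

(** Divided by rho, the image of Lebesgue measure under the map agrees with Lebesgue measure on
    half-open intervals, and these determine it. *)
Lemma lebesgue_measure_affine (rho b : R) (A : set (measurableTypeR R)) : 0 < rho -> measurable A ->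
  lebesgue_measure ((fun a : measurableTypeR R => rho^-1 * (a - b) : measurableTypeR R) @^-1` A) =
  (rho%:E * lebesgue_measure A)%E.
Proof.
move=> rho0 mA.
set g := fun a : measurableTypeR R => rho^-1 * (a - b) : measurableTypeR R.
have mg : measurable_fun setT g.
  by apply: measurable_funM => //; exact: measurable_funB.
have ri0 : 0 <= rho^-1 by rewrite invr_ge0 ltW.
pose P : {measure set (measurableTypeR R) -> \bar R} :=
  measure_function_pushforward__canonical__measure_function_Measure
    (@lebesgue_measure R) mg.
pose mu := mscale (NngNum ri0) P.
suff -> : lebesgue_measure A = mu A.
  by rewrite /mu /mscale/= muleA -EFinM divff ?mul1e// gt_eqF.
apply: lebesgue_measure_unique => // _ [[u v] /= _ <-].
rewrite /mu /mscale/= /pushforward.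
have -> : g @^-1` `]u, v] = `](rho * u + b), (rho * v + b)]%classic.
  by apply/seteqP; split => a /=; rewrite /g !in_itv/= ltr_pdivlMl// ler_pdivrMl// ltrBrDr lerBlDr.
rewrite !lebesgue_measure_itv/= !lte_fin ltrD2r ltr_pM2l//.
case: ifPn => _; last by rewrite mule0.
rewrite -!EFinB -EFinM; congr (_%:E).
by field; rewrite gt_eqF.
Qed.

Lemma vcons0 d (p : measurableTypeR R * 'rV[R]_d) : vcons p ord0 ord0 = p.1.
Proof.
have -> : (ord0 : 'I_d.+1) = lshift d (ord0 : 'I_1) by exact/val_inj.
exact: etrans (row_mxEl _ _ _ _) (mxE _ _ _ _).
Qed.

Lemma vconsS d (p : measurableTypeR R * 'rV[R]_d) (j : 'I_d) :
  vcons p ord0 (rshift 1 j : 'I_d.+1) = p.2 ord0 j.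
Proof. exact: row_mxEr. Qed.

Lemma ord_case d (i : 'I_d.+1) : i = ord0 \/ exists j, i = rshift 1 j.
Proof.
case: (@splitP 1 d i) => j ij; last by right; exists j; exact/val_inj.
by left; apply: ord_inj; rewrite [LHS]ij ord1.
Qed.

(** Induction along the definition of [lebesgue_rV]: the section at [a] of the preimage is the
    preimage of the section at [g a], which yields rho ^ d, and the change of variable in the first
    coordinate yields the remaining factor rho. *)
Lemma lebesgue_rV_affine d rho b (A : set 'rV[R]_d) : 0 < rho -> measurable A ->
  lebesgue_rV d (affine rho b @^-1` A) = ((rho ^+ d)%:E * lebesgue_rV d A)%E.
Proof.
move=> rho0; elim: d b A => [|d IH] b A mA.
  rewrite expr0 mul1e; congr (lebesgue_rV 0 _); apply/seteqP.
  by split => x /=; rewrite (thinmx0 x) (thinmx0 (affine _ _ _)).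
have mAg : measurable (@vcons R d @^-1` A).
  by rewrite -[X in measurable X]setTI; exact: measurable_vcons.
pose g := fun a : measurableTypeR R => rho^-1 * (a - b ord0 ord0) : measurableTypeR R.
have mg : measurable_fun setT g.
  by apply: measurable_funM => //; exact: measurable_funB.
rewrite /= /lebesgue_rVS /pushforward /product_measure1/=.
pose phi a := lebesgue_rV d (xsection (@vcons R d @^-1` A) a).
have mphi : measurable_fun setT phi by exact: measurable_fun_xsection.
transitivity (\int[lebesgue_measure]_a ((rho ^+ d)%:E * phi (g a)))%E.
  apply: eq_integral => a _; rewrite -(IH (rsubmx (b : 'rV_(1 + d)))); last exact: measurable_xsection.
  congr (lebesgue_rV d _); apply/seteqP.
  have e y : affine rho b (vcons (a, y)) = vcons (g a, affine rho (rsubmx (b : 'rV_(1 + d))) y).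
    apply/rowP => i; case: (ord_case i) => [->|[j ->]].
      by rewrite affineE !vcons0.
    by rewrite affineE !vconsS affineE mxE.
  by split => y /=; rewrite /xsection/= !inE /= e.
rewrite ge0_integralZl//; last 2 first.
  exact: measurableT_comp.
  by rewrite lee_fin exprn_ge0// ltW.
rewrite exprSr EFinM -muleA; congr (_ * _)%E.
have phi0 a : (0 <= phi a)%E by exact: measure_ge0.
have ri0 : 0 <= rho by exact: ltW.
pose P : {measure set (measurableTypeR R) -> \bar R} :=
  measure_function_pushforward__canonical__measure_function_Measure
    (@lebesgue_measure R) mg.
transitivity (\int[P]_a phi a)%E.
  by rewrite ge0_integral_pushforward.
rewrite -[RHS](ge0_integral_mscale (@lebesgue_measure R) measurableT (NngNum ri0))//.
apply: eq_measure_integral => B mB _.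
by rewrite /P/= /pushforward lebesgue_measure_affine.
Qed.

Lemma lebesgue_rV_cube d : lebesgue_rV d (unit_cube R d) = 1%E.
Proof.
elim: d => [|d IH].
  by rewrite /= diracE mem_set// => -[].
rewrite /= /lebesgue_rVS /pushforward.
have -> : @vcons R d @^-1` unit_cube R d.+1 = `[0, 1]%classic `*` unit_cube R d.
  apply/seteqP; split => -[a v] /=; rewrite in_itv/=.
    move=> h; split; first by have := h ord0; rewrite vcons0.
    by move=> i; have := h (rshift 1 i); rewrite vconsS.
  move=> [h0 h] i; case: (ord_case i) => [->|[j ->]]; first by rewrite vcons0.
  by rewrite vconsS; exact: h.
rewrite product_measure1E//; last exact: measurable_cube.
rewrite [X in (_ * X)%E](IH : lebesgue_rV d _ = _) mule1.
have h : lebesgue_measure (`[0, 1]%classic : set (measurableTypeR R)) = 1%E :> \bar R.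
  by rewrite lebesgue_measure_itv/= lte_fin ltr01 sube0.
exact: h.
Qed.

Lemma measurable_disc d rho : measurable (@disc R d rho).
Proof.
rewrite -[X in measurable X]setTI.
rewrite (_ : disc d rho = (@enorm R d) @^-1` `]-oo, rho[).
  by apply: (measurable_enorm (@measurable_id _ _ _)).
by apply/seteqP; split => x /=; rewrite in_itv.
Qed.

Lemma enormZ d k (x : 'rV[R]_d) : 0 <= k -> enorm (k *: x) = k * enorm x.
Proof.
move=> k0; rewrite /enorm.
under eq_bigr do rewrite mxE exprMn.
by rewrite -mulr_sumr sqrtrM ?sqr_ge0// sqrtr_sqr ger0_norm.
Qed.

Lemma enorm_eq0 d (x : 'rV[R]_d) : (enorm x == 0) = (x == 0).
Proof.
apply/idP/eqP => [|->]; last first.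
  rewrite /enorm big1 ?sqrtr0// => i _; by rewrite mxE expr0n.
rewrite /enorm sqrtr_eq0 => h.
have /eqP : \sum_(i < d) x ord0 i ^+ 2 == 0.
  by rewrite eq_le h sumr_ge0// => i _; exact: sqr_ge0.
move/psumr_eq0P => h0; apply/rowP => i; rewrite mxE; apply/eqP.
by rewrite -sqrf_eq0 h0// => j _; exact: sqr_ge0.
Qed.

Lemma lebesgue_rV_disc_lty d : (lebesgue_rV d (@disc R d 1) < +oo)%E.
Proof.
(* With this b, [affine 2 b] sends the cube of side 2 centred at the origin, which contains the unit
   disc, to the unit cube. *)
pose b : 'rV[R]_d := const_mx (-1).
apply: (@le_lt_trans _ _ (lebesgue_rV d (affine 2 b @^-1` unit_cube R d))); last first.
  by rewrite lebesgue_rV_affine//; [rewrite lebesgue_rV_cube mule1 ltry|exact: measurable_cube].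
apply: le_measure; rewrite ?inE; first exact: measurable_disc.
  by rewrite -[X in measurable X]setTI; apply: measurable_affine => //; exact: measurable_cube.
move=> x /= x1 i; rewrite affineE mxE opprK.
have : `|x ord0 i| <= 1.
  apply: le_trans (ltW x1); rewrite /enorm -sqrtr_sqr ler_sqrt.
    by rewrite (bigD1 i)//= lerDl sumr_ge0// => j _; exact: sqr_ge0.
  by apply: sumr_ge0 => j _; exact: sqr_ge0.
rewrite ler_norml => /andP[h1 h2]; apply/andP; split; lra.
Qed.

Lemma unit_ball_volumeE d : (unit_ball_volume R d)%:E = lebesgue_rV d (@disc R d 1).
Proof. by rewrite /unit_ball_volume fineK// ge0_fin_numE// lebesgue_rV_disc_lty. Qed.

Lemma unit_ball_volume_ge0 d : 0 <= unit_ball_volume R d.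
Proof. exact: fine_ge0. Qed.

Lemma lebesgue_rV_ball d rho (x : 'rV[R]_d) : 0 < rho ->
  lebesgue_rV d [set y | enorm (x - y) < rho] = (rho ^+ d * unit_ball_volume R d)%:E.
Proof.
move=> rho0; rewrite EFinM unit_ball_volumeE -(lebesgue_rV_affine x)//; last exact: measurable_disc.
congr (lebesgue_rV d _); apply/seteqP; split => y; rewrite /= /disc/= /affine enormZ ?invr_ge0 ?ltW//.
  by rewrite ltr_pdivrMl// mulr1 enorm_distC.
by rewrite ltr_pdivrMl// mulr1 enorm_distC.
Qed.

Lemma intensity_ge0 d lambda r : 0 <= lambda -> 0 < r -> 0 <= intensity d lambda r :> R.
Proof.
move=> l0 r0; rewrite /intensity divr_ge0// mulr_ge0 ?unit_ball_volume_ge0//.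
by rewrite exprn_ge0// ltW.
Qed.

(** The origin of the constant 2 ^ d lambda. As an inequality it also covers a ball volume equal to
    0, where the left side is 0, so positivity of that volume does not have to be established. *)
Lemma intensity_ball d lambda r : 0 <= lambda -> 0 < r ->
  intensity d lambda r * ((2 * r) ^+ d * unit_ball_volume R d) <= 2 ^+ d * lambda.
Proof.
move=> l0 r0; rewrite /intensity.
have [->|v0] := eqVneq (unit_ball_volume R d) 0.
  by rewrite mulr0 mulr0 mulr_ge0// exprn_ge0.
have r0' : r ^+ d != 0 by rewrite expf_neq0// gt_eqF.
rewrite exprMn le_eqVlt; apply/orP; left; apply/eqP.
by field; rewrite r0' v0.
Qed.

End euclidean.

(** * Bad points and resampling *)

Section config_measurability.
Context {R : realType} {d : nat}.
Notation X := 'rV[R]_d.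
Notation N := (config R d).

Lemma measurable_configP d' (T : measurableType d') (f : T -> N) :
  (forall A, measurable A -> measurable (f @^-1` avoids A)) -> measurable_fun setT f.
Proof.
move=> mf; apply: (@measurability _ _ _ _ _ _ (@avoid_events R d)) => //.
by move=> _ [_ [A mA <-] <-]; rewrite setTI; exact: mf.
Qed.

Lemma nnmf_psum d' (T : measurableType d') (g : T -> N) (f : T * X -> \bar R) :
  measurable_fun setT g -> nnmf f -> nnmf (fun t => \sum_(x <- g t) f (t, x))%E.
Proof.
move=> mg nf; have nfx t : nnmf (fun x => f (t, x)).
  by apply: (nnmf_comp nf); exact: measurable_pair1.
have := nnmf_family (measurable_family_point mg) nf.
by congr nnmf; apply/funext => t; rewrite integral_point_measure.
Qed.

(** The event says that the sum of the indicator of [U] over the points vanishes. Measurability of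
    deletion, of the good points and of the region all come from this quantification over random
    points. *)
Lemma measurable_forall_point d' (T : measurableType d') (g : T -> N) (U : set (T * X)) :
  measurable_fun setT g -> measurable U ->
  measurable [set t | forall x, x \in g t -> ~ U (t, x)].
Proof.
move=> mg mU; have [_ ms] := nnmf_psum mg (nnmf_indic mU).
rewrite -[X in measurable X]setTI.
suff -> : [set t | forall x, x \in g t -> ~ U (t, x)] =
    (fun t => \sum_(x <- g t) (\1_U (t, x))%:E : \bar R)%E @^-1` [set 0%E].
  by apply: ms => //; exact: emeasurable_set1.
apply/seteqP; split => t /= h.
  by rewrite big_seq big1// => x /h Ux; rewrite indicE memNset.
move=> x xg Ux; have : (\sum_(x <- g t) (\1_U (t, x))%:E)%E == 0%E :> \bar R by apply/eqP.
rewrite (big_rem x)//= indicE mem_set//= padde_eq0// ?lee_fin ?ler01//; last first.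
  by apply: sume_ge0 => y _; rewrite lee_fin.
by rewrite eqe oner_eq0.
Qed.

Lemma measurable_diag : measurable [set p : X * X | p.1 = p.2].
Proof.
rewrite -[X in measurable X]setTI.
rewrite (_ : [set p | _] = (fun p : X * X => enorm (p.1 - p.2)) @^-1` [set 0]).
  by apply: measurable_enorm => //; exact: measurable_rV_sub.
apply/seteqP; split => -[x y] /=; first by move=> ->; apply/eqP; rewrite enorm_eq0 subrr.
by move=> /eqP; rewrite enorm_eq0 subr_eq0 => /eqP.
Qed.

Definition del (x : X) (eta : N) : N := (eta `\ x)%fset.

Lemma in_del x eta y : (y \in del x eta) = (y != x) && (y \in eta).
Proof. exact: in_fsetD1. Qed.

Lemma measurable_fun_del d' (T : measurableType d') (f : T -> X) (g : T -> N) :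
  measurable_fun setT f -> measurable_fun setT g ->
  measurable_fun setT (fun t => del (f t) (g t)).
Proof.
move=> mf mg; apply: measurable_configP => A mA.
pose U := ((fun q : T * X => q.2) @^-1` A) `&`
   ~` ((fun q : T * X => (q.2, f q.1)) @^-1` [set p : X * X | p.1 = p.2]).
have mU : measurable U.
  apply: measurableI; first exact: (measurable_preimage (@measurable_snd _ _ T X) mA).
  apply: measurableC; apply: measurable_preimage; last exact: measurable_diag.
  by apply: measurable_fun_pair => //; exact: measurableT_comp.
have := measurable_forall_point mg mU; congr measurable.
apply/seteqP; split => t /= h x.
  rewrite in_del => /andP[xf xg] Ax; apply: (h x xg); split => //= e.
  by rewrite e eqxx in xf.
move=> xg [/= Ax /eqP xf]; apply: (h x) => //.
by rewrite in_del xf.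
Qed.

Variable r : R.

Definition close (x y : X) : bool := enorm (x - y) < 2 * r.

Lemma closeC x y : close x y = close y x.
Proof. by rewrite /close enorm_distC. Qed.

Lemma measurable_close : measurable [set p : X * X | close p.1 p.2].
Proof.
rewrite (_ : [set p | _] = (fun p : X * X => enorm (p.1 - p.2)) @^-1` `]-oo, (2 * r)[).
  apply: measurable_preimage => //.
  by apply: measurable_enorm => //; exact: measurable_rV_sub.
by apply/seteqP; split => p /=; rewrite in_itv.
Qed.

(** For r > 0 every point is close to itself, so isolation of a point x of [eta] is always tested
    against [del x eta]. *)
Definition isolated_from (x : X) (eta : N) : bool := all (fun y => ~~ close x y) eta.

Lemma isolated_fromP x eta : reflect (forall y, y \in eta -> ~ close x y) (isolated_from x eta).
Proof.
apply: (iffP allP) => h y ye; first by apply/negP; exact: h.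
by apply/negP; exact: h.
Qed.

Lemma measurable_isolated d' (T : measurableType d') (f : T -> X) (g : T -> N) :
  measurable_fun setT f -> measurable_fun setT g ->
  measurable [set t | isolated_from (f t) (g t)].
Proof.
move=> mf mg.
have mU : measurable ((fun q : T * X => (f q.1, q.2)) @^-1` [set p : X * X | close p.1 p.2]).
  apply: measurable_preimage; last exact: measurable_close.
  by apply: measurable_fun_pair => //; exact: measurableT_comp.
have := measurable_forall_point mg mU; congr measurable.
by apply/seteqP; split => t /= => [h|/isolated_fromP h y /h//]; apply/isolated_fromP.
Qed.

Definition bad (eta : N) : N := [fset x in eta | ~~ isolated_from x (del x eta)]%fset.
Definition good (eta : N) : N := [fset x in eta | isolated_from x (del x eta)]%fset.

Lemma in_bad eta x : (x \in bad eta) = (x \in eta) && ~~ isolated_from x (del x eta).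
Proof. by rewrite !inE. Qed.

Lemma in_good eta x : (x \in good eta) = (x \in eta) && isolated_from x (del x eta).
Proof. by rewrite !inE. Qed.

Lemma measurable_good d' (T : measurableType d') (g : T -> N) :
  measurable_fun setT g -> measurable_fun setT (fun t => good (g t)).
Proof.
move=> mg; apply: measurable_configP => A mA.
have mU : measurable (((fun q : T * X => q.2) @^-1` A) `&`
   [set q : T * X | isolated_from q.2 (del q.2 (g q.1))]).
  apply: measurableI; first exact: (measurable_preimage (@measurable_snd _ _ T X) mA).
  apply: measurable_isolated => //; apply: measurable_fun_del => //.
  exact: measurableT_comp.
have := measurable_forall_point mg mU; congr measurable.
apply/seteqP; split => t /= h x.
  by rewrite in_good => /andP[xg ix] Ax; exact: (h x xg).
by move=> xg [Ax ix]; apply: (h x) => //; rewrite in_good xg.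
Qed.

Lemma measurable_fsetU d' (T : measurableType d') (f g : T -> N) :
  measurable_fun setT f -> measurable_fun setT g ->
  measurable_fun setT (fun t => (f t `|` g t)%fset : N).
Proof.
move=> mf mg; apply: measurable_configP => A mA.
have := measurableI _ _ (measurable_preimage mf (measurable_avoids mA))
  (measurable_preimage mg (measurable_avoids mA)); congr measurable.
apply/seteqP; split => t /=.
  by move=> [h1 h2] x; rewrite in_fsetU => /orP[/h1|/h2].
by move=> h; split => x xx; apply: h; rewrite in_fsetU xx ?orbT.
Qed.

Definition region (eta : N) : set X :=
  [set x | unit_cube R d x /\ exists2 y, y \in bad eta & close x y].

Lemma measurable_region : measurable [set p : X * N | region p.2 p.1].
Proof.
have mU : measurable ([set q : (X * N) * X | close q.1.1 q.2] `&`
   ~` [set q : (X * N) * X | isolated_from q.2 (del q.2 q.1.2)]).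
  apply: measurableI.
    apply: (@measurable_preimage _ _ _ _ (fun q : (X * N) * X => (q.1.1, q.2)) _ _ measurable_close).
    by apply: measurable_fun_pair => //; exact: measurableT_comp.
  apply: measurableC; apply: measurable_isolated => //; apply: measurable_fun_del => //.
  exact: measurableT_comp.
have m2 := measurableC (measurable_forall_point (@measurable_snd _ _ X N) mU).
have m1 : measurable (fst @^-1` unit_cube R d : set (X * N)).
  by apply: measurable_preimage => //; exact: measurable_cube.
have := measurableI _ _ m1 m2; congr measurable.
apply/seteqP; split => -[x eta] /= [cx h]; split => //.
  apply: contrapT => k; apply: h => y ye [/= ny /negP iy]; apply: k.
  by exists y => //; rewrite in_bad ye.
move: h => [y]; rewrite in_bad => /andP[ye iy] ny k.
by apply: (k y ye); split => //=; exact/negP.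
Qed.

Lemma isolated_notin_region x eta : isolated_from x eta -> ~ region eta x.
Proof.
by move=> /isolated_fromP ix [_ [y]]; rewrite in_bad => /andP[/ix].
Qed.

Lemma bad_del x eta : isolated_from x (del x eta) -> bad (del x eta) = bad eta.
Proof.
move=> ix; apply/fsetP => y; rewrite !in_bad in_del.
have [->|yx] := eqVneq y x; first by rewrite /= ix andbF.
rewrite /=; case ye : (y \in eta) => //=; congr (~~ _).
apply/isolated_fromP/isolated_fromP => h z.
  rewrite in_del => /andP[zy ze]; have [zx|zx] := eqVneq z x; last first.
    by apply: h; rewrite !in_del zy zx.
  rewrite zx closeC; apply: (isolated_fromP _ _ ix).
  by rewrite in_del yx.
by rewrite !in_del => /and3P[zy zx ze]; apply: h; rewrite in_del zy.
Qed.

Lemma region_del x eta : isolated_from x (del x eta) -> region (del x eta) = region eta.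
Proof. by move=> ix; rewrite /region bad_del. Qed.

Lemma good_del x eta : isolated_from x (del x eta) -> good (del x eta) = del x (good eta).
Proof.
move=> ix; apply/fsetP => y; have : (y \in bad (del x eta)) = (y \in bad eta) by rewrite bad_del.
rewrite !in_bad in_good in_del in_del in_good.
have [->|yx] := eqVneq y x => //=.
by case: (y \in eta) => //= /negb_inj.
Qed.

Lemma good_not_region x eta : x \in good eta -> ~ region eta x.
Proof.
rewrite in_good => /andP[xe ix]; rewrite -(region_del ix).
exact: isolated_notin_region.
Qed.

Definition resample (p q : N) : N := (good p `|` q)%fset.

(** The union is disjoint: a kept point lies outside the region, and all fresh points lie inside. *)
Lemma big_resample (p q : N) (F : X -> \bar R) : (forall x, x \in q -> region p x) ->
  (\sum_(x <- resample p q) F x =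
   \sum_(x <- q) F x + \sum_(x <- p | isolated_from x (del x p)) F x)%E.
Proof.
move=> qp; rewrite -[X in (_ + X)%E]big_filter -big_cat; apply: perm_big.
apply: uniq_perm; first exact: fset_uniq.
  rewrite cat_uniq fset_uniq filter_uniq// ?fset_uniq// andbT /=.
  apply/hasPn => x; rewrite mem_filter => /andP[ix xp]; apply/negP => /qp.
  by apply: good_not_region; rewrite in_good xp.
move=> x; rewrite in_fsetU in_good mem_cat mem_filter orbC.
by congr (_ || _); rewrite andbC.
Qed.

(** This lemma and the next let the reduced configuration of a resampled one be computed from the
    two parts. A fresh x is no good point of p, so deleting it affects q only; a kept x is no point
    of q, and its deletion from p leaves the other good points good. *)
Lemma del_resample_fresh (p q : N) x : x \in q -> (forall y, y \in q -> region p y) ->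
  del x (resample p q) = resample p (del x q).
Proof.
move=> xq qp; apply/fsetP => y; rewrite in_del !in_fsetU in_del.
have [->|//] := eqVneq y x; rewrite /= orbF.
by apply/esym/negP => /good_not_region; apply; exact: qp.
Qed.

Lemma del_resample_kept (p q : N) x : x \in p -> isolated_from x (del x p) ->
  (forall y, y \in q -> region p y) -> del x (resample p q) = resample (del x p) q.
Proof.
move=> xp ix qp; apply/fsetP => y; rewrite in_del !in_fsetU good_del// in_del.
have [->|//] := eqVneq y x; rewrite /=.
apply/esym/negP => /qp; apply: good_not_region.
by rewrite in_good xp.
Qed.

End config_measurability.

(** * From point sets to configurations *)

Section bridge.
Context {R : realType} {d : nat}.
Notation X := 'rV[R]_d.
Notation N := (config R d).
Variable r : R.

Lemma BadPointsE (eta : N) : BadPoints r [set` eta] = [set` bad r eta].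
Proof.
apply/seteqP; split => x /=.
  move=> [_ [[y z] /= [ye ze yz nyz] <-]] /=.
  move=> [->|->]; rewrite in_bad.
    rewrite [y \in _]ye/=; apply/isolated_fromP => /(_ z); apply => //.
    by rewrite in_del [z \in _]ze andbT eq_sym; exact/eqP.
  rewrite [z \in _]ze/=; apply/isolated_fromP => /(_ y); apply.
    by rewrite in_del [y \in _]ye andbT; exact/eqP.
  by rewrite closeC.
rewrite in_bad => /andP[xe /allPn[y]].
rewrite in_del => /andP[yx ye] /negPn nxy.
exists [set x; y]; last by left.
by exists (x, y) => //; split => //=; apply/eqP; rewrite eq_sym.
Qed.

Lemma resampling_regionE (eta : N) : resampling_region r [set` eta] = region r eta.
Proof.
rewrite /resampling_region BadPointsE /region; apply/seteqP; split => x /=.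
  move=> [[a ab [b bd <-]] cx]; split => //; exists a => //.
  by rewrite /close addrC addKr.
move=> [cx [y yb nxy]]; split => //; exists y => //; exists (x - y) => //.
by rewrite addrC subrK.
Qed.

Lemma npointsE (A : set X) (eta : N) : npoints A [set` eta] = card_in A eta.
Proof.
rewrite /npoints /card_in -size_filter.
apply/perm_size/uniq_perm; [exact: fset_uniq|exact/filter_uniq/fset_uniq|].
move=> x; rewrite mem_filter in_fset_set; last first.
  by apply: finite_setIl; exact: finite_fset.
by rewrite in_setI andbC mem_setE.
Qed.

End bridge.

(** * Mass and mean of the Poisson law *)

Lemma poisson_mass_ge0 (R : realType) (a : R) n : (0 <= a)%R -> (0 <= poisson_mass a n)%R.
Proof. by move=> a0; rewrite /poisson_mass divr_ge0// mulr_ge0 ?expR_ge0 ?exprn_ge0. Qed.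

Lemma poisson_mass0 (R : realType) (a : R) : poisson_mass a 0 = expR (- a).
Proof. by rewrite /poisson_mass expr0 fact0 divr1 mulr1. Qed.

(** The term n = 0 vanishes, and the factor n + 1 of the next ones cancels against the factorial,
    leaving a e^-a times the exponential series. *)
Lemma poisson_mean (R : realType) (a : R) : 0 <= a ->
  (\sum_(n <oo) (n%:R * poisson_mass a n)%:E = a%:E)%E.
Proof.
move=> a0.
have t0 n : 0 <= n%:R * poisson_mass a n.
  by rewrite mulr_ge0// /poisson_mass divr_ge0// mulr_ge0 ?expR_ge0 ?exprn_ge0.
rewrite nneseries_recl//; last by move=> n; rewrite lee_fin.
rewrite mul0r add0e.
have e n : n.+1%:R * poisson_mass a n.+1 = a * expR (- a) * exp_coeff a n.
  rewrite /poisson_mass /exp_coeff /= factS natrM exprS.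
  have : n`!%:R != 0 :> R by rewrite pnatr_eq0 -lt0n fact_gt0.
  have : n.+1%:R != 0 :> R by rewrite pnatr_eq0.
  move: (n.+1%:R : R) (n`!%:R : R) => u v u0 v0.
  by field; rewrite v0 u0.
rewrite -(nneseries_addn 1)//.
under eq_eseriesr do rewrite addn1 e EFinM.
rewrite nneseriesZl//; last first.
  by move=> n _; rewrite lee_fin divr_ge0// exprn_ge0.
have -> : (\sum_(0 <= i <oo) (exp_coeff a i)%:E = (expR a)%:E)%E.
  rewrite /expR -EFin_lim; last exact: is_cvg_series_exp_coeff.
  by congr (limn _); apply/funext => n /=; rewrite sumEFin.
by rewrite -EFinM -mulrA -expRD addNr expR0 mulr1.
Qed.

(** * The Mecke formula *)

Section uniqueness.
Context {R : realType} {d : nat}.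
Notation X := 'rV[R]_d.
Notation N := (config R d).

(** A point, a past configuration and a fresh one. The fresh one is tested by avoidance only, since
    this is where its conditional law is explicit. *)
Definition box_event (p : (set X * set N) * set X) : set ((X * N) * N) :=
  (p.1.1 `*` p.1.2) `*` avoids p.2.

Definition box_events : set (set ((X * N) * N)) :=
  [set box_event p | p in [set p | [/\ measurable p.1.1, measurable p.1.2 & measurable p.2]]].

Lemma box_event_measurable p : measurable p.1.1 -> measurable p.1.2 -> measurable p.2 ->
  measurable (box_event p).
Proof.
move=> m1 m2 m3; apply: measurableX; first exact: measurableX.
exact: measurable_avoids.
Qed.

Lemma avoids0 : avoids set0 = setT :> set N.
Proof. by apply/seteqP; split => // eta _ x _. Qed.

(** The identity from the space carrying the sigma-algebra generated by boxes is measurable because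
    its three components are; for the last one, avoidance events suffice by [measurable_configP]. *)
Lemma measurable_box_events : measurable = <<s box_events >>.
Proof.
apply/seteqP; split; last first.
  apply: smallest_sub; first exact: sigma_algebra_measurable.
  by move=> _ [p [m1 m2 m3] <-]; exact: box_event_measurable.
pose T := g_sigma_algebraType box_events.
have mb p : measurable p.1.1 -> measurable p.1.2 -> measurable p.2 ->
    measurable (box_event p : set T).
  by move=> m1 m2 m3; apply: sub_sigma_algebra; exists p.
have m11 : measurable_fun setT (fun t : T => t.1.1 : X).
  move=> _ A mA; have := mb ((A, setT), set0) mA measurableT measurable0.
  congr measurable; rewrite /box_event/= avoids0.
  by apply/seteqP; split => [[[x e] q] [[]]|[[x e] q] []].
have m12 : measurable_fun setT (fun t : T => t.1.2 : N).
  move=> _ E mE; have := mb ((setT, E), set0) measurableT mE measurable0.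
  congr measurable; rewrite /box_event/= avoids0.
  by apply/seteqP; split => [[[x e] q] [[]]|[[x e] q] []].
have m2 : measurable_fun setT (fun t : T => t.2 : N).
  apply: measurable_configP => C mC.
  have := mb ((setT, setT), C) measurableT measurableT mC.
  congr measurable; rewrite /box_event/=.
  by apply/seteqP; split => [[[x e] q] [[]]|[[x e] q]].
have mid : measurable_fun setT (fun t : T => (t : (X * N) * N)).
  have := measurable_fun_pair (measurable_fun_pair m11 m12) m2.
  by congr measurable_fun; apply/funext => -[[]].
by move=> A mA; have := mid measurableT _ mA; rewrite setTI.
Qed.

Lemma box_eventsI : setI_closed box_events.
Proof.
move=> _ _ [[[A E] C] [/= m1 m2 m3] <-] [[[A' E'] C'] [/= m1' m2' m3'] <-].
exists ((A `&` A', E `&` E'), C `|` C').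
  by split; [exact: measurableI|exact: measurableI|exact: measurableU].
apply/seteqP; split => -[[x e] q] /=.
  move=> [[/= [Ax Ax'] [Ee Ee']] h]; split; split => //= y yq Cy; apply: (h y yq).
    by left.
  by right.
move=> [[/= [Ax Ee] h] [/= [Ax' Ee'] h']]; split => //= y yq [Cy|Cy].
  exact: (h y).
exact: (h' y).
Qed.

Lemma box_functional_ext Phi Psi :
  integral_functional Phi -> integral_functional Psi ->
  (Phi (fun=> 1) < +oo)%E ->
  (forall A E C, measurable A -> measurable E -> measurable C ->
    Phi (fun x => (\1_(box_event ((A, E), C)) x)%:E) =
    Psi (fun x => (\1_(box_event ((A, E), C)) x)%:E)) ->
  forall f : (X * N) * N -> \bar R, nnmf f -> Phi f = Psi f.
Proof.
move=> iP iQ Poo PQ; apply: (functional_ext iP iQ measurable_box_events box_eventsI) => //.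
  exists ((setT, setT), set0); first by split => /=; [exact: measurableT|exact: measurableT|exact: measurable0].
  by rewrite /box_event/= avoids0 !setXTT.
by move=> _ [[[A E] C] [/= mA mE mC] <-]; exact: PQ.
Qed.

End uniqueness.

Section mecke_formula.
Local Open Scope ereal_scope.
Context {R : realType} {d : nat}.
Notation X := 'rV[R]_d.
Notation N := (config R d).
Context dO (Omega : measurableType dO) (Pr : probability Omega R).
Variables (c : R) (c0 : (0 <= c)%R) (S : N -> set X).
Hypothesis mS : measurable [set p : X * N | S p.2 p.1].
Hypothesis S_cube : forall eta, S eta `<=` unit_cube R d.
Variables (Y Q : Omega -> N).
Hypotheses (mY : measurable_fun setT Y) (mQ : measurable_fun setT Q).

Definition region_mass (A : set X) (eta : N) : R :=
  (c * fine (lebesgue_rV d (A `&` S eta)))%R.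

(** Two disjoint sets are the right amount of information: one in which points are counted, one that
    has to be avoided. *)
Hypothesis poissonQ : forall A1 A2 n1 n2 E, measurable A1 -> measurable A2 ->
  A1 `&` A2 = set0 -> measurable E ->
  Pr (Y @^-1` E `&` [set w | card_in A1 (Q w) = n1 /\ card_in A2 (Q w) = n2]) =
  \int[Pr]_(w in Y @^-1` E)
    (poisson_mass (region_mass A1 (Y w)) n1 * poisson_mass (region_mass A2 (Y w)) n2)%:E.

Let measurable_S eta : measurable (S eta).
Proof.
have := measurable_preimage (@measurable_pair2 _ _ X N eta) mS.
by congr measurable.
Qed.

Let S_lty A eta : measurable A -> lebesgue_rV d (A `&` S eta) < +oo.
Proof.
move=> mA; apply: (@le_lt_trans _ _ (lebesgue_rV d (unit_cube R d))).
  apply: le_measure; rewrite ?inE; [exact: measurableI|exact: measurable_cube|].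
  by move=> x [_]; exact: S_cube.
by rewrite lebesgue_rV_cube ltry.
Qed.

Lemma region_massE A eta : measurable A ->
  (region_mass A eta)%:E = c%:E * lebesgue_rV d (A `&` S eta).
Proof. by move=> mA; rewrite EFinM fineK// ge0_fin_numE// S_lty. Qed.

Lemma region_mass_ge0 A eta : (0 <= region_mass A eta)%R.
Proof. by rewrite mulr_ge0// fine_ge0. Qed.

Lemma region_mass_split A C eta : measurable A -> measurable C ->
  region_mass A eta = (region_mass (A `&` C) eta + region_mass (A `\` C) eta)%R.
Proof.
move=> mA mC; apply: EFin_inj; rewrite EFinD !region_massE//; last 2 first.
  exact: measurableD.
  exact: measurableI.
rewrite -ge0_muleDr//; congr (_ * _).
rewrite (measureDI _ (measurableI _ _ mA (measurable_S eta)) mC) addeC.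
by rewrite setIAC [X in _ + X](_ : _ = lebesgue_rV d ((A `\` C) `&` S eta))// setDE setIAC -setDE.
Qed.

Lemma measurable_region_mass A : measurable A -> measurable_fun setT (region_mass A).
Proof.
move=> mA; apply: measurable_funM => //; apply: measurableT_comp => //.
have mU : measurable [set p : N * X | A p.2 /\ S p.1 p.2].
  apply: measurableI.
    exact: (measurable_preimage (@measurable_snd _ _ N X) mA).
  apply: (@measurable_preimage _ _ _ _ (fun p : N * X => (p.2, p.1)) _ _ mS).
  exact: measurable_fun_pair.
have := measurable_fun_xsection (lebesgue_rV d) mU.
congr measurable_fun; apply/funext => eta; congr (lebesgue_rV d _).
by apply/seteqP; split => x; rewrite /xsection/= inE.
Qed.

Lemma measurable_poisson_mass A n : measurable A ->
  measurable_fun setT (fun eta => poisson_mass (region_mass A eta) n).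
Proof.
move=> mA; have mr := measurable_region_mass mA.
apply: measurable_funM => //; apply: measurable_funM.
  by apply: measurableT_comp => //; exact: measurableT_comp.
exact: measurable_funX.
Qed.

Lemma region_mass_set0 eta : region_mass set0 eta = 0%R.
Proof. by rewrite /region_mass set0I measure0 /= mulr0. Qed.

Lemma card_in_set0 (eta : N) : card_in set0 eta = 0%N.
Proof. by rewrite /card_in; apply/eqP; rewrite -leqn0 leqNgt -has_count; apply/hasPn => x; rewrite in_set0. Qed.

Lemma card_in_eq0 A (eta : N) : card_in A eta = 0%N <-> avoids A eta.
Proof.
have := card_in_gt0 A eta; case: (card_in A eta) => [|n] h.
  by split => // _; apply: contrapT => /h.
by split => // a; have /h := isT.
Qed.

Lemma in_avoids A (eta : N) : (eta \in avoids A) = (card_in A eta == 0%N).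
Proof.
apply/idP/eqP => [/set_mem|] h; first by apply/card_in_eq0.
by apply/mem_set/card_in_eq0.
Qed.

Lemma card_in_del A x (eta : N) : x \in eta ->
  card_in A eta = ((x \in A) + card_in A (del x eta))%N.
Proof.
move=> xe; rewrite /card_in -/(count (fun x => x \in A) (x :: del x eta)).
apply: (@seq.permP _ eta (x :: del x eta)); apply: uniq_perm.
- exact: fset_uniq.
- by rewrite /= in_del eqxx fset_uniq.
- by move=> y; rewrite inE in_del; have [->|] := eqVneq y x.
Qed.

Lemma sum_indic_card_in A (eta : N) :
  \sum_(x <- eta) (\1_A x)%:E = (card_in A eta)%:R%:E :> \bar R.
Proof.
rewrite sumEFin /card_in -sum1_count natr_sum [in RHS]big_mkcond.
by congr (_%:E); apply: eq_bigr => x _; rewrite indicE; case: ifP.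
Qed.

(** The condition that C holds exactly one point, and that it lies in A, is written with the
    disjoint sets [A] meet [C] and [C] minus [A], to match the form of [poissonQ]. *)
Lemma sum_avoids A C (eta : N) :
  \sum_(x <- eta) (\1_A x)%:E * (\1_(avoids C) (del x eta))%:E =
  (\1_(avoids C) eta)%:E * (card_in (A `\` C) eta)%:R%:E
  + (\1_[set eta | card_in (A `&` C) eta = 1%N /\ card_in (C `\` A) eta = 0%N] eta)%:E :> \bar R.
Proof.
transitivity (\sum_(x <- eta) ((\1_(avoids C) eta)%:E * (\1_(A `\` C) x)%:E +
    (card_in C eta == 1%N)%:R%:E * (\1_(A `&` C) x)%:E) : \bar R).
  apply: eq_big_seq => x xe; rewrite !indicE !in_avoids in_setD in_setI (card_in_del C xe).
  rewrite -!EFinM -EFinD; congr (_%:E).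
  case: (x \in A); case: (x \in C) => /=;
    rewrite ?add0n ?add1n ?eqSS /= ?mul0r ?mulr0 ?mul1r ?mulr1 ?addr0 ?add0r//.
rewrite big_split/= -!ge0_sume_distrr//.
rewrite !sum_indic_card_in; congr (_ + _).
rewrite -EFinM indicE; congr (_%:E).
have := card_in_split C A eta; rewrite setIC => ->.
set D := [set _ | _]; have [h|h] := boolP (eta \in D).
  by move/set_mem : h => [-> ->]; rewrite mulr1.
case: eqP => [e|_]; last by rewrite mul0r.
rewrite mul1r; have [->//|n0] := eqVneq (card_in (A `&` C) eta) 0%N.
exfalso; move/negP: h; apply; apply/mem_set.
rewrite /D/=; move: (card_in _ eta) (card_in _ eta) e n0 => u v e n0.
by split; lia.
Qed.

(** The conditional void probability of [Q] given [Y], used as a rewriting rule under the integral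
    in both directions. For the indicator of an event of [Y] it is [poissonQ] with both counts 0 and
    an empty second set; [functional_ext] does the rest. *)
Lemma expectation_exchange f C : nnmf f -> measurable C ->
  \int[Pr]_w ((\1_(avoids C) (Q w))%:E * f (Y w)) =
  \int[Pr]_w ((expR (- region_mass C (Y w)))%:E * f (Y w)).
Proof.
move=> nf mC.
have mav : measurable (Q @^-1` avoids C).
  by apply: measurable_preimage => //; exact: measurable_avoids.
apply: (@functional_ext _ _ N measurable
  (fun f => \int[Pr]_w ((\1_(avoids C) (Q w))%:E * f (Y w)))
  (fun f => \int[Pr]_w ((expR (- region_mass C (Y w)))%:E * f (Y w)))) => //.
- by apply: integral_functional_integral => //; exact: (nnmf_indic mav).
- apply: integral_functional_integral => //; split.
    by move=> w; rewrite lee_fin expR_ge0.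
  apply/measurable_EFinP; apply: measurableT_comp => //; apply: measurableT_comp => //.
  by apply: (measurableT_comp (measurable_region_mass mC)).
- by rewrite sigma_algebra_id//; exact: sigma_algebra_measurable.
- by move=> A B; exact: measurableI.
- apply: (@le_lt_trans _ _ (\int[Pr]_w 1)).
    apply: ge0_le_integral => //.
    + by under eq_fun do rewrite mule1; exact: (nnmf_mfun (nnmf_indic mav)).
    + by move=> w _; rewrite mule1 lee_fin indicE; case: (_ \in _).
  by rewrite integral_cst// mul1e (le_lt_trans (probability_le1 Pr measurableT))// ltry.
move=> E mE.
have := @poissonQ C set0 0%N 0%N E mC measurable0 (setI0 _) mE.
have mYE : measurable (Y @^-1` E) by exact: measurable_preimage.
move=> h; transitivity (Pr (Y @^-1` E `&` (Q @^-1` avoids C))).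
  rewrite -[in RHS](setIT (_ `&` _)) -integral_indic//; last exact: measurableI.
  apply: eq_integral => w _; rewrite indicI/= muleC.
  by rewrite -EFinM.
transitivity (\int[Pr]_(w in Y @^-1` E)
    (poisson_mass (region_mass C (Y w)) 0 * poisson_mass (region_mass set0 (Y w)) 0)%:E).
  rewrite -h; congr (Pr (_ `&` _)); apply/seteqP; split => w /=.
    by rewrite card_in_set0 => /card_in_eq0.
  by move=> [/card_in_eq0].
rewrite integral_mkcond; apply: eq_integral => w _.
rewrite patchE region_mass_set0 !poisson_mass0 oppr0 expR0 mulr1.
have -> : (w \in Y @^-1` E) = (Y w \in E) by [].
by rewrite indicE; case: ifPn => _; rewrite ?mule1 ?mule0.
Qed.


Lemma measurable_card_in_fun A : measurable A ->
  measurable_fun setT (fun eta : N => (card_in A eta)%:R%:E : \bar R).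
Proof.
move=> mA; under eq_fun do rewrite -sum_indic_card_in.
have := @nnmf_psum R d _ N id (fun p => (\1_A p.2)%:E) (@measurable_id _ _ _).
move=> h; apply: nnmf_mfun; apply: h.
apply: (nnmf_comp (nnmf_indic mA)); exact: measurable_snd.
Qed.

(** Decomposition according to the number n of points in A: the count in A and the avoidance of C
    factor given [Y], and the resulting series is the Poisson mean. *)
Let expectation_count A C E : measurable A -> measurable C -> A `&` C = set0 -> measurable E ->
  \int[Pr]_w ((\1_(avoids C) (Q w))%:E * (card_in A (Q w))%:R%:E * (\1_E (Y w))%:E) =
  \int[Pr]_w ((expR (- region_mass C (Y w)))%:E * (region_mass A (Y w))%:E * (\1_E (Y w))%:E).
Proof.
move=> mA mC AC mE.
have mYE : measurable (Y @^-1` E) by exact: measurable_preimage.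
pose W n := Y @^-1` E `&` [set w | card_in A (Q w) = n /\ card_in C (Q w) = 0%N].
have mW n : measurable (W n).
  apply: measurableI => //; apply: measurableI.
    exact: (measurable_preimage mQ (measurable_card_in n mA)).
  exact: (measurable_preimage mQ (measurable_card_in 0 mC)).
transitivity (\int[Pr]_w \sum_(n <oo) (n%:R * \1_(W n) w)%:E).
  apply: eq_integral => w _; rewrite (@nneseriesD1 _ _ (card_in A (Q w)))//.
  rewrite eseries0 ?adde0; last first.
    move=> n _ /= /eqP nA; rewrite indicE memNset ?mulr0// => -[_ [nA' _]].
    by apply: nA.
  rewrite -!EFinM; congr (_%:E); rewrite mulrAC mulrC; congr (_ * _)%R.
  rewrite !indicE in_avoids -natrM mulnb; congr (_%:R); congr nat_of_bool.
  apply/idP/idP => [/andP[/eqP h /set_mem Yw]|/set_mem[Yw [_ h]]].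
    by apply/mem_set.
  by rewrite h eqxx; exact/mem_set.
rewrite integral_nneseries//; last by move=> n; apply/measurable_EFinP; apply: measurable_funM.
have pm0 B n w : (0 <= poisson_mass (region_mass B (Y w)) n)%R.
  by apply: poisson_mass_ge0; exact: region_mass_ge0.
have mp B n : measurable B -> measurable_fun setT (fun w => poisson_mass (region_mass B (Y w)) n).
  by move=> mB; exact: (measurableT_comp (measurable_poisson_mass n mB) mY).
transitivity (\sum_(n <oo) \int[Pr]_w (n%:R * (poisson_mass (region_mass A (Y w)) n *
    poisson_mass (region_mass C (Y w)) 0 * \1_E (Y w)))%:E).
  apply: eq_eseriesr => n _; under eq_integral do rewrite EFinM.
  rewrite ge0_integralZl//; last by apply/measurable_EFinP; exact: measurable_indic.
  rewrite integral_indic// setIT [X in _ * X](poissonQ _ _ mA mC AC mE).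
  rewrite -ge0_integralZl//; last 2 first.
    apply/measurable_EFinP; apply: measurable_funTS; apply: measurable_funM; exact: mp.
    by move=> w _; rewrite lee_fin mulr_ge0.
  rewrite integral_mkcond; apply: eq_integral => w _; rewrite patchE.
  have -> : (w \in Y @^-1` E) = (Y w \in E) by [].
  by rewrite indicE; case: ifPn => _; rewrite ?mulr1 ?mulr0 -?EFinM.
rewrite -integral_nneseries//; last 2 first.
  move=> n; apply/measurable_EFinP; apply: measurable_funM => //; apply: measurable_funM.
    by apply: measurable_funM; exact: mp.
  by apply: measurableT_comp => //; exact: measurable_indic.
  by move=> n w _; rewrite lee_fin; do 3 ?apply: mulr_ge0.
apply: eq_integral => w _.
rewrite -[X in _ = _ * X * _](poisson_mean (region_mass_ge0 _ _)).
rewrite -nneseriesZl//; last first.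
  by move=> n _; rewrite lee_fin mulr_ge0.
rewrite muleC -nneseriesZl//; last first.
  by move=> n _; apply: mule_ge0; rewrite lee_fin ?expR_ge0// mulr_ge0.
apply: eq_eseriesr => n _; rewrite -!EFinM poisson_mass0; congr (_%:E).
by ring.
Qed.

Let expectation_single A C E : measurable A -> measurable C -> A `&` C = set0 -> measurable E ->
  \int[Pr]_w ((\1_[set eta | card_in A eta = 1%N /\ card_in C eta = 0%N] (Q w))%:E * (\1_E (Y w))%:E) =
  \int[Pr]_w ((region_mass A (Y w))%:E * (expR (- (region_mass A (Y w) + region_mass C (Y w))))%:E
     * (\1_E (Y w))%:E).
Proof.
move=> mA mC AC mE.
have mYE : measurable (Y @^-1` E) by exact: measurable_preimage.
have mD : measurable [set eta : N | card_in A eta = 1%N /\ card_in C eta = 0%N].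
  by apply: measurableI; exact: measurable_card_in.
have mQD := measurable_preimage mQ mD.
transitivity (Pr (Y @^-1` E `&` (Q @^-1` [set eta : N | card_in A eta = 1%N /\ card_in C eta = 0%N]))).
  rewrite -[in RHS](setIT (_ `&` _)) -integral_indic//; last exact: measurableI.
  by apply: eq_integral => w _; rewrite indicI/= muleC -EFinM.
rewrite [LHS](poissonQ _ _ mA mC AC mE) integral_mkcond.
apply: eq_integral => w _; rewrite patchE.
have -> : (w \in Y @^-1` E) = (Y w \in E) by [].
rewrite indicE; case: ifPn => _; rewrite ?mule1 ?mule0// -EFinM; congr (_%:E).
by rewrite poisson_mass0 /poisson_mass expr1 factS fact0 muln1 divr1 opprD expRD; ring.
Qed.

Let region_integral A eta (k : R) : measurable A -> (0 <= k)%R ->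
  \int[lebesgue_rV d]_x ((c * \1_(S eta) x)%:E * (\1_A x * k)%:E) = (region_mass A eta * k)%:E.
Proof.
move=> mA k0; transitivity (\int[lebesgue_rV d]_x ((c * k)%:E * (\1_(A `&` S eta) x)%:E)).
  by apply: eq_integral => x _; rewrite indicI/= -!EFinM; congr (_%:E); ring.
have mAS : measurable (A `&` S eta) by exact: measurableI.
rewrite ge0_integralZl//; last 2 first.
  by apply/measurable_EFinP; exact: measurable_indic.
  by rewrite lee_fin mulr_ge0.
by rewrite integral_indic// setIT EFinM muleAC -region_massE// -EFinM.
Qed.

Lemma box_eventE A C E x (eta q : N) :
  \1_(box_event ((A, E), C)) ((x, eta), q) = (\1_A x * (\1_E eta * \1_(avoids C) q))%R :> R.
Proof.
rewrite !indicE -!natrM !mulnb; congr (_%:R); congr nat_of_bool.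
apply/idP/and3P => [/set_mem[[/= h1 h2] h3]|[/set_mem h1 /set_mem h2 /set_mem h3]].
  by split; exact/mem_set.
exact/mem_set.
Qed.

(* On a box event A x E x {avoids C}, the sum over x splits into the points of A
   outside C, where removing x changes nothing, and those in C, where x has to
   be the only point of Q w in C. *)
Theorem mecke (F : (X * N) * N -> \bar R) : nnmf F ->
  \int[Pr]_w (\sum_(x <- Q w) F ((x, Y w), del x (Q w))) =
  \int[Pr]_w \int[lebesgue_rV d]_x ((c * \1_(S (Y w)) x)%:E * F ((x, Y w), Q w)).
Proof.
pose u (p : Omega * X) : \bar R := (c * \1_(S (Y p.1)) p.2)%:E.
have mu : nnmf u.
  split; first by move=> p; rewrite lee_fin mulr_ge0.
  have mU : measurable ((fun p : Omega * X => (p.2, Y p.1)) @^-1` [set p : X * N | S p.2 p.1]).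
    apply: measurable_preimage => //; apply: measurable_fun_pair => //.
    exact: measurableT_comp.
  by apply/measurable_EFinP; apply: measurable_funM => //; exact: (measurable_indic mU).
have iR := @integral_functional_iter R _ ((X * N) * N)%type _ Omega _ X Pr
  (fun=> lebesgue_rV d) u (fun p => ((p.2, Y p.1), Q p.1)) (@measurable_family_cst _ _ _ _ _ _) mu.
have mphi : measurable_fun setT (fun p : Omega * X => ((p.2, Y p.1), Q p.1)).
  apply: measurable_fun_pair; last exact: measurableT_comp.
  by apply: measurable_fun_pair => //; exact: measurableT_comp.
have mpsi : measurable_fun setT (fun p : Omega * X => ((p.2, Y p.1), del p.2 (Q p.1))).
  apply: measurable_fun_pair; last by apply: measurable_fun_del => //; exact: measurableT_comp.
  by apply: measurable_fun_pair => //; exact: measurableT_comp.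
have iL := @integral_functional_iter R _ ((X * N) * N)%type _ Omega _ X Pr
  (fun w => point_measure (Q w)) (fun=> 1%E) (fun p => ((p.2, Y p.1), del p.2 (Q p.1)))
  (measurable_family_point mQ) (nnmf_cst lee01) (fun=> isT) mpsi.
have LE H : nnmf H -> \int[Pr]_w \int[point_measure (Q w)]_x (1 * H ((x, Y w), del x (Q w))) =
    \int[Pr]_w (\sum_(x <- Q w) H ((x, Y w), del x (Q w))).
  move=> nH; apply: eq_integral => w _; under eq_integral do rewrite mul1e.
  rewrite integral_point_measure//.
  exact: (nnmf_comp (nnmf_comp nH mpsi) (@measurable_pair1 _ _ Omega X w)).
move=> nF; rewrite -LE//; apply/esym.
(* Both sides are functionals of F, and the Lebesgue side is at most c at the constant 1 because the
   region lies in a cube of volume 1. It remains to compare them on boxes. *)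
apply: (box_functional_ext (iR _ _) iL) nF => //.
  apply: (@le_lt_trans _ _ (\int[Pr]_w c%:E)).
    apply: ge0_le_integral => //.
    + move=> w _; apply: integral_ge0 => x _; rewrite mule1; exact: nnmf_ge0 mu _.
    + have h := @nnmf_family R _ Omega _ X (fun=> lebesgue_rV d) (fun p => u p * 1)
        (@measurable_family_cst _ _ _ _ _ _) (nnmfM mu (nnmf_cst lee01)).
      exact: (nnmf_mfun h).
    + move=> w _; have := region_integral (Y w) measurableT ler01.
      rewrite mulr1 => h; apply: (@le_trans _ _ (region_mass setT (Y w))%:E).
        rewrite -h le_eqVlt; apply/orP; left; apply/eqP.
        by apply: eq_integral => x _; rewrite indicT mulr1.
      rewrite region_massE// setTI -[leRHS]mule1; apply: lee_wpmul2l; first by rewrite lee_fin.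
      rewrite -(lebesgue_rV_cube d); apply: le_measure; rewrite ?inE//.
      exact: measurable_cube.
  by rewrite integral_cst// (le_lt_trans (lee_wpmul2l _ (probability_le1 Pr measurableT)))// mule1 ltry.
move=> A E C mA mE mC.
have mb := box_event_measurable (p := ((A, E), C)) mA mE mC.
apply: (eq_trans _ (esym (LE _ (nnmf_indic mb)))).
have mY' B : measurable B -> measurable_fun setT (fun w => region_mass B (Y w)).
  by move=> mB; exact: (measurableT_comp (measurable_region_mass mB) mY).
(* Integrating the box over x gives the mass of A times the indicators of E and of avoidance; the
   latter is then exchanged for its conditional probability. *)
transitivity (\int[Pr]_w ((expR (- region_mass C (Y w)))%:E * (region_mass A (Y w) * \1_E (Y w))%:E)).
  rewrite -(expectation_exchange (f := fun eta => (region_mass A eta * \1_E eta)%:E))//; last first.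
    split; first by move=> eta; rewrite lee_fin mulr_ge0// region_mass_ge0.
    apply/measurable_EFinP; apply: measurable_funM; first exact: measurable_region_mass.
    exact: measurable_indic.
  apply: eq_integral => w _.
  transitivity (\int[lebesgue_rV d]_x ((c * \1_(S (Y w)) x)%:E *
      (\1_A x * (\1_E (Y w) * \1_(avoids C) (Q w)))%:E)).
    by apply: eq_integral => x _; rewrite -box_eventE.
  by rewrite region_integral// -EFinM; congr (_%:E); ring.
have mAC : measurable (A `\` C) by exact: measurableD.
have mCA : measurable (C `\` A) by exact: measurableD.
have mIC : measurable (A `&` C) by exact: measurableI.
have nE : nnmf (fun w => (\1_E (Y w))%:E : \bar R) by exact: (nnmf_comp (nnmf_indic mE)).
transitivity (
  \int[Pr]_w ((\1_(avoids C) (Q w))%:E * (card_in (A `\` C) (Q w))%:R%:E * (\1_E (Y w))%:E) +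
  \int[Pr]_w ((\1_[set eta | card_in (A `&` C) eta = 1%N /\ card_in (C `\` A) eta = 0%N] (Q w))%:E * (\1_E (Y w))%:E)).
  rewrite expectation_count//; last by rewrite setDE -setIA setICl setI0.
  rewrite expectation_single//; last by apply/seteqP; split => // x [[Ax _] [_ /(_ Ax)]].
  have nm B : measurable B -> nnmf (fun w => (region_mass B (Y w))%:E).
    move=> mB; split; first by move=> w; rewrite lee_fin region_mass_ge0.
    by apply/measurable_EFinP; exact: mY'.
  have ne (f : Omega -> R) : measurable_fun setT f -> nnmf (fun w : Omega => (expR (- f w))%:E : \bar R).
    move=> mf; split; first by move=> w; rewrite lee_fin expR_ge0.
    by apply/measurable_EFinP; apply: measurableT_comp => //; exact: measurableT_comp.
  rewrite -nnmf_integralD; last 2 first.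
    apply: nnmfM => //; apply: nnmfM; last exact: nm.
    by apply: ne; exact: mY'.
    apply: nnmfM => //; apply: nnmfM; first exact: nm.
    by apply: ne; apply: measurable_funD; exact: mY'.
  apply: eq_integral => w _; rewrite -!EFinM -EFinD; congr (_%:E).
  (* Both terms contain exp of minus the mass of C, and the masses of [A] minus [C] and of [A] meet
     [C] add up to that of A. *)
  rewrite (region_mass_split (Y w) mA mC) (region_mass_split (Y w) mC mA) setIC.
  by ring.
have mD : measurable [set eta : N | card_in (A `&` C) eta = 1%N /\ card_in (C `\` A) eta = 0%N].
  by apply: measurableI; exact: measurable_card_in.
rewrite -nnmf_integralD.
- apply: eq_integral => w _.
  transitivity ((\sum_(x <- Q w) (\1_A x)%:E * (\1_(avoids C) (del x (Q w)))%:E) * (\1_E (Y w))%:E : \bar R).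
    by rewrite sum_avoids ge0_muleDl// ?mule_ge0.
  rewrite ge0_sume_distrl//.
  by apply: eq_bigr => x _; rewrite box_eventE -!EFinM; congr (_%:E); ring.
- apply: nnmfM => //; apply: nnmfM; first exact: (nnmf_comp (nnmf_indic (measurable_avoids mC)) mQ).
  split; first by move=> w; rewrite lee_fin.
  exact: (measurableT_comp (measurable_card_in_fun mAC) mQ).
- by apply: nnmfM => //; exact: (nnmf_comp (nnmf_indic mD) mQ).
Qed.

End mecke_formula.

(** * Domination of the Papangelou intensity *)

Section papangelou.
Local Open Scope ereal_scope.
Context {R : realType} {d : nat}.
Notation X := 'rV[R]_d.
Notation N := (config R d).
Context dO (Omega : measurableType dO) (Pr : probability Omega R).
Variables (c : R) (c0 : (0 <= c)%R).

Definition cube_weight (x : X) : \bar R := (c * \1_(unit_cube R d) x)%:E.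

Lemma nnmf_cube_weight : nnmf cube_weight.
Proof.
split; first by move=> x; rewrite lee_fin mulr_ge0.
apply/measurable_EFinP; apply: measurable_funM => //.
by apply: measurable_indic; exact: measurable_cube.
Qed.

Lemma integral_cube_weight : \int[lebesgue_rV d]_x cube_weight x = c%:E.
Proof.
under eq_integral do rewrite /cube_weight EFinM.
rewrite ge0_integralZl//; last first.
  by apply/measurable_EFinP; apply: measurable_indic; exact: measurable_cube.
rewrite integral_indic//; last exact: measurable_cube.
by rewrite setIT [X in _ * X]lebesgue_rV_cube mule1.
Qed.

(** A one-sided Georgii-Nguyen-Zessin equation. This integral form bounds the Papangelou intensity
    without presupposing that it exists as a density. *)
Definition intensity_dominated (P : Omega -> N) : Prop :=
  forall F : X * N -> \bar R, nnmf F ->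
  \int[Pr]_w (\sum_(x <- P w) F (x, del x (P w))) <=
  \int[Pr]_w \int[lebesgue_rV d]_x (cube_weight x * F (x, P w)).

Variable r : R.
Variables (P Q : Omega -> N).
Hypotheses (mP : measurable_fun setT P) (mQ : measurable_fun setT Q).
Hypothesis QP : forall w x, x \in Q w -> region r (P w) x.
Hypothesis poissonQ : forall A1 A2 n1 n2 E, measurable A1 -> measurable A2 ->
  A1 `&` A2 = set0 -> measurable E ->
  Pr (P @^-1` E `&` [set w | card_in A1 (Q w) = n1 /\ card_in A2 (Q w) = n2]) =
  \int[Pr]_(w in P @^-1` E)
    (poisson_mass (region_mass c (region r) A1 (P w)) n1 *
     poisson_mass (region_mass c (region r) A2 (P w)) n2)%:E.
Hypothesis domP : intensity_dominated P.

Definition isolated_indic (x : X) (eta : N) : \bar R := (isolated_from r x eta)%:R%:E.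

Lemma nnmf_isolated_indic d' (T : measurableType d') (f : T -> X) (g : T -> N) :
  measurable_fun setT f -> measurable_fun setT g -> nnmf (fun t => isolated_indic (f t) (g t)).
Proof.
move=> mf mg; suff -> : (fun t => isolated_indic (f t) (g t)) = (fun t => (\1_[set t | isolated_from r (f t) (g t)] t)%:E).
  by apply: nnmf_indic; exact: measurable_isolated.
apply/funext => t; rewrite indicE /isolated_indic; congr ((nat_of_bool _)%:R%:E).
by apply/idP/idP => [/mem_set//|/set_mem].
Qed.

Let mPd : measurable_fun setT (fun p : Omega * X => del p.2 (P p.1)).
Proof. by apply: measurable_fun_del => //; exact: measurableT_comp. Qed.

Let mP1 : measurable_fun setT (fun p : Omega * X => P p.1).
Proof. exact: measurableT_comp. Qed.

Let mQ1 : measurable_fun setT (fun p : Omega * X => Q p.1).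
Proof. exact: measurableT_comp. Qed.

Let m2 : measurable_fun setT (fun p : Omega * X => p.2).
Proof. exact: measurable_snd. Qed.

Let u1 (p : Omega * X) : \bar R := isolated_indic p.2 (del p.2 (P p.1)).
Let u2 (p : Omega * X) : \bar R := cube_weight p.2 * isolated_indic p.2 (P p.1).

Let nu1 : nnmf u1. Proof. exact: nnmf_isolated_indic. Qed.
Let nu2 : nnmf u2.
Proof. by apply: nnmfM; [exact: (nnmf_comp nnmf_cube_weight m2)|exact: nnmf_isolated_indic]. Qed.

Let phi1 (p : Omega * X) : X * N := (p.2, del p.2 (P p.1)).
Let phi2 (p : Omega * X) : X * N := (p.2, P p.1).
Let mphi1 : measurable_fun setT phi1. Proof. exact: measurable_fun_pair. Qed.
Let mphi2 : measurable_fun setT phi2. Proof. exact: measurable_fun_pair. Qed.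

(** [Phi1] and [Psi1] are the two sides of [domP] for test functions that vanish unless x is
    isolated: the part of the bound concerning points that survive the step. *)
Let Phi1 (f : X * N -> \bar R) :=
  \int[Pr]_w \int[point_measure (P w)]_x (u1 (w, x) * f (phi1 (w, x))).
Let Psi1 (f : X * N -> \bar R) :=
  \int[Pr]_w \int[lebesgue_rV d]_x (u2 (w, x) * f (phi2 (w, x))).

Let iPhi1 : integral_functional Phi1.
Proof. by apply: integral_functional_iter => //; exact: measurable_family_point. Qed.

Let iPsi1 : integral_functional Psi1.
Proof.
apply: (@integral_functional_iter _ _ _ _ _ _ _ Pr (fun=> lebesgue_rV d)) => //.
exact: measurable_family_cst.
Qed.

Lemma point_integralE (g : Omega -> N) (f : Omega * X -> \bar R) w : nnmf f ->
  \int[point_measure (g w)]_x f (w, x) = \sum_(x <- g w) f (w, x).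
Proof.
move=> nf; rewrite integral_point_measure//.
by apply: (nnmf_comp nf); exact: measurable_pair1.
Qed.

Lemma nnmf_point (g : Omega -> N) (f : Omega * X -> \bar R) : measurable_fun setT g ->
  nnmf f -> nnmf (fun w => \sum_(x <- g w) f (w, x)).
Proof. exact: nnmf_psum. Qed.

Lemma nnmf_lebesgue (f : Omega * X -> \bar R) :
  nnmf f -> nnmf (fun w => \int[lebesgue_rV d]_x f (w, x)).
Proof.
apply: (@nnmf_family _ _ _ _ _ (fun=> lebesgue_rV d)); exact: measurable_family_cst.
Qed.

Let Psi1_lty : Psi1 (fun=> 1) < +oo.
Proof.
apply: (@le_lt_trans _ _ (\int[Pr]_w c%:E)); last first.
  by rewrite integral_cst// (le_lt_trans (lee_wpmul2l _ (probability_le1 Pr measurableT)))// mule1 ltry.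
apply: le_nnmf_integral; last move=> w.
- exact: (nnmf_lebesgue (nnmfM nu2 (nnmf_cst lee01))).
- exact: nnmf_cst.
rewrite -integral_cube_weight; apply: le_nnmf_integral.
- exact: (nnmf_pair1 w (nnmfM nu2 (nnmf_cst lee01))).
- exact: nnmf_cube_weight.
move=> x; rewrite mule1 /u2/= -[leRHS]mule1; apply: lee_wpmul2l.
  exact: nnmf_ge0 nnmf_cube_weight _.
by rewrite /isolated_indic lee_fin; case: isolated_from.
Qed.

Let Phi1_Psi1 f : nnmf f -> Phi1 f <= Psi1 f.
Proof.
move=> nf.
have nF : nnmf (fun p : X * N => isolated_indic p.1 p.2 * f p).
  by apply: nnmfM => //; exact: nnmf_isolated_indic.
apply: le_trans; last first.
  apply: le_trans (domP nF) _.
  rewrite le_eqVlt; apply/orP; left; apply/eqP.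
  apply: eq_integral => w _; apply: eq_integral => x _.
  by rewrite muleA.
rewrite le_eqVlt; apply/orP; left; apply/eqP; apply: eq_integral => w _.
rewrite (@point_integralE _ (fun p => u1 p * f (phi1 p)))//.
by apply: nnmfM => //; exact: nnmf_comp nf mphi1.
Qed.

Let region_cube eta : region r eta `<=` unit_cube R d.
Proof. by move=> x []. Qed.

Let exchange := expectation_exchange (measurable_region r) mP mQ poissonQ.

Let swap1 (a b g e h : \bar R) : a * b * (g * e * h) = e * (a * b * g * h).
Proof. by rewrite [RHS]muleC -!muleA (muleC h e). Qed.

Let swap2 (a b g e h : \bar R) : e * (a * b * g * h) = a * b * h * (g * e).
Proof. by rewrite [LHS]muleC -!muleA; congr (a * (b * _)); rewrite (muleCA h) (muleC h). Qed.

(* The conditional law of Q given P is not available as a kernel.  Writing the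
   hypothesis on P with a density h <= 1 turns it into an equality, which extends
   to functions of Q as well by comparison on box events. *)
Let isolated_bound F : nnmf F ->
  \int[Pr]_w (\sum_(x <- P w) (u1 (w, x) * F (phi1 (w, x), Q w))) <=
  \int[Pr]_w \int[lebesgue_rV d]_x (u2 (w, x) * F (phi2 (w, x), Q w)).
Proof.
move=> nF.
have [h [nh h1 hE]] := functional_density iPhi1 iPsi1 Psi1_lty Phi1_Psi1.
have hf p : h p \is a fin_num by rewrite ge0_fin_numE ?(le_lt_trans (h1 p)) ?ltry// (nnmf_ge0 nh).
pose psi1 p := (phi1 p, Q p.1); pose psi2 p := (phi2 p, Q p.1).
have mpsi1 : measurable_fun setT psi1 by exact: measurable_fun_pair.
have mpsi2 : measurable_fun setT psi2 by exact: measurable_fun_pair.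
have nu3 : nnmf (fun p => u2 p * h (phi2 p)) by apply: nnmfM => //; exact: nnmf_comp nh mphi2.
have iPhi2 := @integral_functional_iter R _ ((X * N) * N)%type _ Omega _ X Pr
  (fun w => point_measure (P w)) u1 psi1 (measurable_family_point mP) nu1 (fun=> isT) mpsi1.
have fu3 p : u2 p * h (phi2 p) \is a fin_num by rewrite fin_numM.
have iPsi2 := @integral_functional_iter R _ ((X * N) * N)%type _ Omega _ X Pr
  (fun=> lebesgue_rV d) _ psi2 (@measurable_family_cst _ _ _ _ _ _) nu3 fu3 mpsi2.
have E2 G : nnmf G -> \int[Pr]_w \int[point_measure (P w)]_x (u1 (w, x) * G (psi1 (w, x))) =
    \int[Pr]_w \sum_(x <- P w) (u1 (w, x) * G (psi1 (w, x))).
  move=> nG; apply: eq_integral => w _.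
  rewrite (@point_integralE P (fun p => u1 p * G (psi1 p)))//.
  by apply: nnmfM => //; exact: nnmf_comp nG mpsi1.
have E1 G : nnmf G -> Phi1 G = \int[Pr]_w \sum_(x <- P w) (u1 (w, x) * G (phi1 (w, x))).
  move=> nG; apply: eq_integral => w _.
  rewrite (@point_integralE P (fun p => u1 p * G (phi1 p)))//.
  by apply: nnmfM => //; exact: nnmf_comp nG mphi1.
rewrite -(E2 F nF).
(* The equality holds with the extra weight h on the Lebesgue side, which is then dropped by h <=
   1. *)
have -> := box_functional_ext iPhi2 iPsi2 _ _ nF.
- apply: le_nnmf_integral.
  + by apply: (nnmf_lebesgue (f := fun p => u2 p * h (phi2 p) * F (psi2 p))); apply: nnmfM => //; exact: nnmf_comp nF mpsi2.
  + by apply: (nnmf_lebesgue (f := fun p => u2 p * F (psi2 p))); apply: nnmfM => //; exact: nnmf_comp nF mpsi2.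
  move=> w; apply: le_nnmf_integral => [||x].
  + by apply: (nnmf_pair1 (f := fun p => u2 p * h (phi2 p) * F (psi2 p))); apply: nnmfM => //; exact: nnmf_comp nF mpsi2.
  + by apply: (nnmf_pair1 (f := fun p => u2 p * F (psi2 p))); apply: nnmfM => //; exact: nnmf_comp nF mpsi2.
  apply: lee_wpmul2r; first exact: nnmf_ge0 nF _.
  rewrite -[leRHS]mule1; apply: lee_wpmul2l; first exact: nnmf_ge0 nu2 _.
  exact: h1.
- exact: le_lt_trans (Phi1_Psi1 (nnmf_cst lee01)) Psi1_lty.
move=> A E C mA mE mC.
pose e eta : \bar R := (expR (- region_mass c (region r) C eta))%:E.
have ne : nnmf e.
  split; first by move=> eta; rewrite lee_fin expR_ge0.
  apply/measurable_EFinP; apply: measurableT_comp => //; apply: measurableT_comp => //.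
  by apply: measurable_region_mass => //; exact: measurable_region.
pose g (p : X * N) : \bar R := (\1_A p.1)%:E * (\1_E p.2)%:E.
have ng : nnmf g.
  apply: nnmfM.
    exact: (nnmf_comp (nnmf_indic mA) (@measurable_fst _ _ X N)).
  exact: (nnmf_comp (nnmf_indic mE) (@measurable_snd _ _ X N)).
have nge : nnmf (fun p : X * N => g p * e p.2).
  by apply: nnmfM => //; exact: (nnmf_comp ne (@measurable_snd _ _ X N)).
have mb := box_event_measurable (p := ((A, E), C)) mA mE mC.
have boxE p q : (\1_(box_event ((A, E), C)) (p, q))%:E = g p * (\1_(avoids C) q)%:E :> \bar R.
  by case: p => x eta; rewrite box_eventE -!EFinM mulrA.
apply: (eq_trans (E2 _ (nnmf_indic mb))).
(* Avoidance of C by [Q] is exchanged for the factor e at [P]. For isolated x the region ignores the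
   deletion of x, so this is e at the reduced configuration and can be absorbed in the test function
   of [hE]. On the Lebesgue side the exchange is undone. *)
transitivity (\int[Pr]_w ((\1_(avoids C) (Q w))%:E * \sum_(x <- P w) (u1 (w, x) * g (phi1 (w, x))))).
  apply: eq_integral => w _; rewrite ge0_sume_distrr; last first.
    by move=> x _; exact: (nnmf_ge0 (nnmfM nu1 (nnmf_comp ng mphi1)) (w, x)).
  by apply: eq_bigr => x _; rewrite boxE muleA muleC.
pose k1 (eta : N) : \bar R := \sum_(x <- eta) (isolated_indic x (del x eta) * g (x, del x eta)).
pose f2 (q : N * X) := cube_weight q.2 * isolated_indic q.2 q.1 * g (q.2, q.1) * h (q.2, q.1).
pose k2 (eta : N) : \bar R := \int[lebesgue_rV d]_x f2 (eta, x).
have mdel : measurable_fun setT (fun q : N * X => del q.2 q.1) by exact: measurable_fun_del.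
have nk1 : nnmf k1.
  apply: (@nnmf_psum _ _ _ N id (fun q => isolated_indic q.2 (del q.2 q.1) * g (q.2, del q.2 q.1))) => //.
  apply: nnmfM; first exact: nnmf_isolated_indic.
  by apply: (nnmf_comp ng); exact: measurable_fun_pair.
have msw : measurable_fun setT (fun q : N * X => (q.2, q.1)) by exact: measurable_fun_pair.
have nf2 : nnmf f2.
  apply: nnmfM; last exact: nnmf_comp nh msw.
  apply: nnmfM; last exact: nnmf_comp ng msw.
  by apply: nnmfM; [exact: (nnmf_comp nnmf_cube_weight (@measurable_snd _ _ N X))|exact: nnmf_isolated_indic].
have nk2 : nnmf k2.
  by apply: (@nnmf_family _ _ _ _ _ (fun=> lebesgue_rV d)) nf2; exact: measurable_family_cst.
apply: (eq_trans (exchange nk1 mC)).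
transitivity (Phi1 (fun p => g p * e p.2)).
  rewrite E1//; apply: eq_integral => w _; rewrite ge0_sume_distrr; last first.
    by move=> x _; exact: (nnmf_ge0 (nnmfM nu1 (nnmf_comp ng mphi1)) (w, x)).
  apply: eq_bigr => x _; rewrite /u1 /phi1 /isolated_indic/=.
  case: (boolP (isolated_from r x (del x (P w)))) => [ix|_]; last by rewrite !mul0e mule0.
  by rewrite !mul1e muleC /e /region_mass region_del.
apply: (eq_trans (hE _ nge)).
transitivity (\int[Pr]_w (e (P w) * k2 (P w))).
  apply: eq_integral => w _; rewrite /k2 -(nnmf_integralZ _ (nnmf_pair1 (P w) nf2) (nnmf_ge0 ne _)).
  apply: eq_integral => x _; rewrite /f2 /u2 /phi2/=.
  exact: swap1.
rewrite -(exchange nk2 mC); apply: eq_integral => w _; rewrite /k2.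
have k0 : 0 <= (\1_(avoids C) (Q w))%:E :> \bar R by rewrite lee_fin indicE ler0n.
rewrite -(nnmf_integralZ (k := (\1_(avoids C) (Q w))%:E) _ (nnmf_pair1 (P w) nf2) k0).
apply: eq_integral => x _; rewrite boxE /f2 /u2 /phi2/=.
exact: swap2.
Qed.

Let mpsiQ : measurable_fun setT (fun p : Omega * X => ((p.2, P p.1), del p.2 (Q p.1))).
Proof.
apply: measurable_fun_pair; last exact: measurable_fun_del.
exact: measurable_fun_pair.
Qed.

Let mpsi1 : measurable_fun setT (fun p : Omega * X => (phi1 p, Q p.1)).
Proof. exact: measurable_fun_pair. Qed.

Let mpsi2 : measurable_fun setT (fun p : Omega * X => (phi2 p, Q p.1)).
Proof. exact: measurable_fun_pair. Qed.

(** Fresh points obey the Mecke formula with density c on the region, kept points [isolated_bound]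
    with density c on the points isolated from [P w]; these sets are disjoint, so the total is at
    most c on the cube. The summand [H] may depend on the old and fresh configurations separately,
    which is what keeps the region visible in the energy estimates. *)
Lemma resample_bound (F : (X * N) * N -> \bar R) (H : Omega -> X -> \bar R) : nnmf F ->
  (forall w x, x \in Q w -> H w x = F ((x, P w), del x (Q w))) ->
  (forall w x, x \in P w -> isolated_from r x (del x (P w)) ->
    H w x = F ((x, del x (P w)), Q w)) ->
  \int[Pr]_w (\sum_(x <- resample r (P w) (Q w)) H w x) <=
  \int[Pr]_w \int[lebesgue_rV d]_x (cube_weight x * F ((x, P w), Q w)).
Proof.
move=> nF HQ HP.
have nF1 := nnmf_comp nF mpsiQ.
have nF2 := nnmf_comp nF mpsi1.
have nF3 := nnmf_comp nF mpsi2.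
rewrite (eq_integral (fun w => \sum_(x <- Q w) F ((x, P w), del x (Q w)) +
    \sum_(x <- P w) (u1 (w, x) * F (phi1 (w, x), Q w)))); last first.
  move=> w _; rewrite big_resample//; last exact: QP.
  congr (_ + _); first by apply: eq_big_seq => x; exact: HQ.
  rewrite big_mkcond; apply: eq_big_seq => x xP; rewrite /u1 /isolated_indic/=.
  by case: ifPn => ix; rewrite ?mul0e// mul1e HP.
rewrite (nnmf_integralD _ (nnmf_point mQ nF1) (nnmf_point mP (nnmfM nu1 nF2))).
rewrite (mecke c0 (measurable_region r) region_cube mP mQ poissonQ nF).
apply: le_trans (leeD2l _ (isolated_bound nF)) _.
have nS : nnmf (fun p : Omega * X => (c * \1_(region r (P p.1)) p.2)%:E).
  split; first by move=> p; rewrite lee_fin mulr_ge0.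
  apply/measurable_EFinP; apply: measurable_funM => //.
  have mU := measurable_preimage mphi2 (measurable_region r).
  exact: (measurable_indic mU).
rewrite -(nnmf_integralD _ (nnmf_lebesgue (nnmfM nS nF3)) (nnmf_lebesgue (nnmfM nu2 nF3))).
have nW : nnmf (fun p : Omega * X => cube_weight p.2) by exact: (nnmf_comp nnmf_cube_weight m2).
apply: le_nnmf_integral.
- by apply: nnmfD; [exact: (nnmf_lebesgue (nnmfM nS nF3))|exact: (nnmf_lebesgue (nnmfM nu2 nF3))].
- exact: (nnmf_lebesgue (nnmfM nW nF3)).
move=> w; rewrite -(nnmf_integralD _ (nnmf_pair1 w (nnmfM nS nF3)) (nnmf_pair1 w (nnmfM nu2 nF3))).
apply: le_nnmf_integral.
- exact: (nnmfD (nnmf_pair1 w (nnmfM nS nF3)) (nnmf_pair1 w (nnmfM nu2 nF3))).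
- exact: (nnmf_pair1 w (nnmfM nW nF3)).
move=> x; rewrite -ge0_muleDl; last 2 first.
- by rewrite lee_fin mulr_ge0.
- exact: nnmf_ge0 nu2 (w, x).
apply: lee_wpmul2r; first exact: nnmf_ge0 nF3 (w, x).
rewrite /u2 /cube_weight /isolated_indic/= -EFinM -EFinD lee_fin -mulrA -mulrDr; apply: ler_wpM2l => //.
rewrite !indicE; case: (boolP (isolated_from r x (P w))) => [ix|_].
  by rewrite memNset ?add0r ?mulr1//; exact: isolated_notin_region.
rewrite mulr0 addr0 ler_nat; case: (boolP (x \in region r _)) => // /set_mem[cx _].
by rewrite mem_set.
Qed.

Lemma dominated_resample : intensity_dominated (fun w => resample r (P w) (Q w)).
Proof.
move=> F nF.
have mn : measurable_fun setT (fun q : (X * N) * N => (q.1.1, resample r q.1.2 q.2)).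
  apply: measurable_fun_pair; first exact: measurableT_comp.
  apply: measurable_fsetU => //; apply: measurable_good.
  exact: measurableT_comp.
apply: (resample_bound (nnmf_comp nF mn)) => w x.
  by move=> xQ /=; rewrite del_resample_fresh//; exact: QP.
by move=> xP ix /=; rewrite del_resample_kept//; exact: QP.
Qed.

(** * Contraction of the expected number of bad pairs *)

Variables (beta : R) (beta0 : (0 <= beta)%R).
Hypothesis ball_beta : forall x, c%:E * lebesgue_rV d [set y | close r x y] <= beta%:E.

Definition close_indic (x y : X) : \bar R := (close r x y)%:R%:E.

(* Every bad pair is counted twice. *)
Definition energy (eta : N) : \bar R := \sum_(x <- eta) \sum_(y <- del x eta) close_indic x y.

Lemma close_indic_ge0 x y : 0 <= close_indic x y.
Proof. by rewrite lee_fin ler0n. Qed.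

Lemma nnmf_close : nnmf (fun p : X * X => close_indic p.1 p.2).
Proof.
suff -> : (fun p : X * X => close_indic p.1 p.2) = (fun p => (\1_[set p | close r p.1 p.2] p)%:E).
  by apply: nnmf_indic; exact: measurable_close.
apply/funext => p; rewrite indicE /close_indic; congr ((nat_of_bool _)%:R%:E).
by apply/idP/idP => [/mem_set//|/set_mem].
Qed.

Lemma nnmf_close_comp d' (T : measurableType d') (f g : T -> X) :
  measurable_fun setT f -> measurable_fun setT g -> nnmf (fun t => close_indic (f t) (g t)).
Proof. by move=> mf mg; exact: (nnmf_comp nnmf_close (measurable_fun_pair mf mg)). Qed.

Lemma close_indicC x y : close_indic x y = close_indic y x.
Proof. by rewrite /close_indic closeC. Qed.

Lemma integral_close x : \int[lebesgue_rV d]_y (cube_weight y * close_indic x y) <= beta%:E.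
Proof.
have mB : measurable [set y | close r x y].
  exact: (measurable_preimage (@measurable_pair1 _ _ X X x) (@measurable_close R d r)).
apply: le_trans (ball_beta x).
have nB : nnmf (fun y : X => (\1_[set y | close r x y] y)%:E : \bar R) by exact: nnmf_indic.
have <- : \int[lebesgue_rV d]_y (\1_[set y | close r x y] y)%:E =
    lebesgue_rV d [set y | close r x y] by rewrite integral_indic// setIT.
have ce0 : 0 <= c%:E by rewrite lee_fin.
rewrite -(nnmf_integralZ _ nB ce0).
apply: le_nnmf_integral => [||y].
- by apply: nnmfM; [exact: nnmf_cube_weight|exact: nnmf_close_comp].
- by apply: nnmfM => //; exact: nnmf_cst.
rewrite -!EFinM lee_fin -mulrA; apply: ler_wpM2l => //.
rewrite !indicE -natrM ler_nat; case: (boolP (close r x y)) => [nxy|_]; last by rewrite muln0.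
by rewrite [X in (_ <= nat_of_bool X)%N]mem_set// muln1 leq_b1.
Qed.

Let mn : measurable_fun setT (fun q : (X * N) * N => resample r q.1.2 q.2).
Proof. by apply: measurable_fsetU => //; apply: measurable_good; exact: measurableT_comp. Qed.

(** For a close pair of the resampled configuration this condition holds automatically. It is
    inserted before x and y become integration variables, because afterwards nothing would tie them
    to the region. *)
Definition touching : set ((X * N) * X) :=
  [set q | region r q.1.2 q.1.1 \/ region r q.1.2 q.2].

Lemma measurable_touching : measurable touching.
Proof.
apply: measurableU.
  have m : measurable_fun setT (fun q : (X * N) * X => (q.1.1, q.1.2)).
    by apply: measurable_fun_pair; exact: measurableT_comp.
  exact: (measurable_preimage m (measurable_region r)).
have m : measurable_fun setT (fun q : (X * N) * X => (q.2, q.1.2)).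
  by apply: measurable_fun_pair => //; exact: measurableT_comp.
exact: (measurable_preimage m (measurable_region r)).
Qed.

Let g (q : (X * N) * X) : \bar R := close_indic q.1.1 q.2 * (\1_touching q)%:E.

Let ng : nnmf g.
Proof.
apply: nnmfM; last exact: nnmf_indic measurable_touching.
by apply: nnmf_close_comp => //; exact: measurableT_comp.
Qed.

Let F1 (t : (X * N) * N) : \bar R := \sum_(y <- resample r t.1.2 t.2) g (t.1, y).

Let nF1 : nnmf F1.
Proof.
apply: (@nnmf_psum _ _ _ _ (fun t : (X * N) * N => resample r t.1.2 t.2) (fun q => g (q.1.1, q.2))) => //.
apply: (nnmf_comp ng); apply: measurable_fun_pair => //.
exact: measurableT_comp.
Qed.

Let G (q : X * N) : \bar R := \int[lebesgue_rV d]_x (cube_weight x * g ((x, q.2), q.1)).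

Let nGf : nnmf (fun t : (X * N) * X => cube_weight t.2 * g ((t.2, t.1.2), t.1.1)).
Proof.
apply: nnmfM; first exact: (nnmf_comp nnmf_cube_weight (@measurable_snd _ _ (X * N)%type X)).
apply: (nnmf_comp ng); apply: measurable_fun_pair; last exact: measurableT_comp.
by apply: measurable_fun_pair => //; exact: measurableT_comp.
Qed.

Let nG : nnmf G.
Proof.
by apply: (@nnmf_family _ _ _ _ _ (fun=> lebesgue_rV d)) nGf; exact: measurable_family_cst.
Qed.

(** A fresh x lies in the region itself. A kept x has no close point among the old ones, so any
    point close to it is fresh. Either way the pair is touching. *)
Lemma energy_resample_le1 : \int[Pr]_w energy (resample r (P w) (Q w)) <=
  \int[Pr]_w \int[lebesgue_rV d]_x (cube_weight x * F1 ((x, P w), Q w)).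
Proof.
apply: (resample_bound nF1) => w x.
  move=> xQ; rewrite del_resample_fresh//; last exact: QP.
  apply: eq_bigr => y _; rewrite /g indicE mem_set ?mule1//.
  by left; exact: QP.
move=> xP ix; rewrite del_resample_kept//; last exact: QP.
apply: eq_big_seq => y; rewrite /g/= in_fsetU => yn.
rewrite /close_indic; case: (boolP (close r x y)) => nxy; last by rewrite mul0e.
rewrite indicE mem_set ?mule1//; right; rewrite /= region_del//.
case/orP: yn => [|/QP//]; rewrite in_good => /andP[yd _].
by exfalso; exact: (isolated_fromP _ _ _ ix y yd).
Qed.

(** The second application of [resample_bound], to the sum over y, once the finite sum has been
    exchanged with the integral over x. Deleting a kept y leaves the region, hence [touching],
    unchanged. *)
Lemma energy_resample_le2 :
  \int[Pr]_w \int[lebesgue_rV d]_x (cube_weight x * F1 ((x, P w), Q w)) <=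
  \int[Pr]_w \int[lebesgue_rV d]_y (cube_weight y * G (y, P w)).
Proof.
rewrite (eq_integral (fun w => \sum_(y <- resample r (P w) (Q w)) G (y, P w))); last first.
  move=> w _; transitivity (\int[lebesgue_rV d]_x
      \sum_(y <- resample r (P w) (Q w)) (cube_weight x * g ((x, P w), y))).
    apply: eq_integral => x _; rewrite ge0_sume_distrr//.
    by move=> y _; exact: nnmf_ge0 ng _.
  have nfy y : nnmf (fun x => cube_weight x * g ((x, P w), y)).
    exact: (nnmf_pair1 (y, P w) nGf).
  rewrite ge0_integral_sum//; first by move=> y; exact: nnmf_mfun (nfy y).
  by move=> y x _; exact: nnmf_ge0 (nfy y) x.
have nF2 : nnmf (fun t : (X * N) * N => G t.1) by exact: (nnmf_comp nG (@measurable_fst _ _ (X * N)%type N)).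
apply: (resample_bound nF2) => w y //= yP iy.
apply: eq_integral => x _; rewrite /g/= !indicE; congr (_ * (_ * _)).
have e : touching ((x, del y (P w)), y) = touching ((x, P w), y).
  by rewrite /touching/= region_del.
congr ((nat_of_bool _)%:R%:E); apply/idP/idP => /set_mem h; apply/mem_set.
  by rewrite e.
by rewrite -e.
Qed.

Lemma nnmf_energy : nnmf energy.
Proof.
apply: (@nnmf_psum _ _ _ N id (fun q => \sum_(y <- del q.2 q.1) close_indic q.2 y)) => //.
have md : measurable_fun setT (fun q : N * X => del q.2 q.1) by exact: measurable_fun_del.
apply: (@nnmf_psum _ _ _ _ _ (fun q : (N * X) * X => close_indic q.1.2 q.2) md).
by apply: nnmf_close_comp => //; exact: measurableT_comp.
Qed.

(** A union bound: each ball around a bad point has mass at most [beta], and each bad point is the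
    first entry of at least one pair counted by [energy]. *)
Lemma region_le_energy eta :
  \int[lebesgue_rV d]_y (cube_weight y * (\1_(region r eta) y)%:E) <= beta%:E * energy eta.
Proof.
have cw0 y : 0 <= cube_weight y := nnmf_ge0 nnmf_cube_weight y.
pose b x : \bar R := (x \in bad r eta)%:R%:E.
have b0 x : 0 <= b x by rewrite lee_fin ler0n.
have nb x : nnmf (fun y => b x * (cube_weight y * close_indic x y)).
  apply: nnmfZ => //; apply: nnmfM; first exact: nnmf_cube_weight.
  exact: nnmf_close_comp.
have mr := measurable_preimage (@measurable_pair2 _ _ X N eta) (measurable_region r).
apply: (@le_trans _ _ (\int[lebesgue_rV d]_y \sum_(x <- eta) b x * (cube_weight y * close_indic x y))).
  apply: le_nnmf_integral => [||y].
  - by apply: nnmfM; [exact: nnmf_cube_weight|exact: (nnmf_indic mr)].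
  - exact: nnmf_sum.
  rewrite indicE; case: (boolP (y \in region r eta)) => [/set_mem[_ [x xb nyx]]|_]; last first.
    by rewrite mule0 sume_ge0// => x _; exact: nnmf_ge0 (nb x) y.
  rewrite mule1; have xe : x \in eta by move: xb; rewrite in_bad => /andP[].
  apply: le_trans (@le_sum_mem _ _ eta _ x (fun x => nnmf_ge0 (nb x) y) xe).
  by rewrite /b xb /close_indic closeC nyx mul1e mule1.
rewrite ge0_integral_sum//; last 2 first.
  by move=> x; exact: nnmf_mfun (nb x).
  by move=> x y _; exact: nnmf_ge0 (nb x) y.
rewrite /energy ge0_sume_distrr; last first.
  by move=> x _; apply: sume_ge0 => y _; exact: close_indic_ge0.
apply: le_sum_seq => x xe.
rewrite nnmf_integralZ//; last first.
  by apply: nnmfM; [exact: nnmf_cube_weight|exact: nnmf_close_comp].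
apply: le_trans (lee_wpmul2l (b0 x) (integral_close x)) _.
rewrite muleC; apply: lee_wpmul2l; first by rewrite lee_fin.
rewrite /b in_bad xe/=; case: (boolP (isolated_from r x _)) => [_|].
  by apply: sume_ge0 => y _; exact: close_indic_ge0.
move=> /allPn[y yd /negPn nxy].
apply: le_trans (@le_sum_mem _ _ _ _ y (close_indic_ge0 x) yd).
by rewrite /close_indic nxy.
Qed.

Lemma energy_resample :
  \int[Pr]_w energy (resample r (P w) (Q w)) <= (2 * beta ^+ 2)%:E * \int[Pr]_w energy (P w).
Proof.
apply: (le_trans energy_resample_le1); apply: (le_trans energy_resample_le2).
have ne : nnmf (fun w => energy (P w)) := nnmf_comp nnmf_energy mP.
have k0 : 0 <= (2 * beta ^+ 2)%:E by rewrite lee_fin mulr_ge0// exprn_ge0.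
rewrite -(nnmf_integralZ _ ne k0).
have nyG : nnmf (fun q : Omega * X => cube_weight q.2 * G (q.2, P q.1)).
  by apply: nnmfM; [exact: (nnmf_comp nnmf_cube_weight m2)|exact: nnmf_comp nG mphi2].
apply: le_nnmf_integral => [||w].
- exact: nnmf_lebesgue nyG.
- exact: nnmfZ.
have cw0 y : 0 <= cube_weight y := nnmf_ge0 nnmf_cube_weight y.
have mr := measurable_preimage (@measurable_pair2 _ _ X N (P w)) (measurable_region r).
pose S y : \bar R := (\1_(region r (P w)) y)%:E.
have nS : nnmf S by exact: (nnmf_indic mr).
have S0 y : 0 <= S y := nnmf_ge0 nS y.
pose s y := cube_weight y * S y.
have ns : nnmf s by apply: nnmfM => //; exact: nnmf_cube_weight.
have s0 y : 0 <= s y := nnmf_ge0 ns y.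
have b0 : 0 <= beta%:E by rewrite lee_fin.
have nx y : nnmf (fun x => s x * close_indic x y) by apply: nnmfM => //; exact: nnmf_close_comp.
have ny y : nnmf (fun x => cube_weight x * close_indic x y).
  by apply: nnmfM; [exact: nnmf_cube_weight|exact: nnmf_close_comp].
have nsn : nnmf (fun q : X * X => cube_weight q.1 * (s q.2 * close_indic q.2 q.1)).
  apply: nnmfM; first exact: (nnmf_comp nnmf_cube_weight (@measurable_fst _ _ X X)).
  apply: nnmfM; first exact: (nnmf_comp ns (@measurable_snd _ _ X X)).
  exact: nnmf_close_comp.
have nI1 : nnmf (fun y => \int[lebesgue_rV d]_x (cube_weight y * (s x * close_indic x y))).
  apply: (@nnmf_family _ _ X _ X (fun=> lebesgue_rV d)) nsn; exact: measurable_family_cst.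
(* The indicator of [touching] is at most the sum of the indicators that x and that y lie in the
   region. If it is y, the integral over x is already at most [beta]. *)
have GE y : G (y, P w) <= \int[lebesgue_rV d]_x (s x * close_indic x y) + S y * beta%:E.
  apply: (@le_trans _ _ (\int[lebesgue_rV d]_x (s x * close_indic x y + S y * (cube_weight x * close_indic x y)))).
    apply: le_nnmf_integral => [||x].
    - exact: (nnmf_pair1 (y, P w) nGf).
    - by apply: nnmfD => //; exact: nnmfZ.
    rewrite /g/= /s -[X in X + _]muleA (muleCA (S y)) -ge0_muleDr; last 2 first.
    - by rewrite mule_ge0// close_indic_ge0.
    - by rewrite mule_ge0// close_indic_ge0.
    apply: lee_wpmul2l => //; rewrite [X in X + _]muleC [X in _ + X]muleC -ge0_muleDr//.
    apply: lee_wpmul2l; first exact: close_indic_ge0.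
    rewrite /S -EFinD lee_fin !indicE -natrD ler_nat.
    case: (boolP (_ \in touching)) => // /set_mem[/= h|/= h].
      by rewrite [X in nat_of_bool X]mem_set// leq_addr.
    by rewrite [X in (_ + nat_of_bool X)%N]mem_set// leq_addl.
  rewrite (nnmf_integralD _ (nx y)); last exact: nnmfZ.
  apply: leeD2l; rewrite nnmf_integralZ//; apply: lee_wpmul2l => //.
  under eq_integral do rewrite close_indicC; exact: integral_close.
apply: (@le_trans _ _ (\int[lebesgue_rV d]_y
    (\int[lebesgue_rV d]_x (cube_weight y * (s x * close_indic x y)) + beta%:E * s y))).
  apply: le_nnmf_integral => [||y].
  - exact: (nnmf_pair1 w nyG).
  - by apply: nnmfD => //; exact: nnmfZ.
  apply: le_trans (lee_wpmul2l (cw0 y) (GE y)) _.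
  rewrite ge0_muleDr//; last 2 first.
  - by apply: integral_ge0 => x _; exact: nnmf_ge0 (nx y) x.
  - exact: mule_ge0.
  rewrite (nnmf_integralZ _ (nx y))// leeD2l// muleA muleC.
  exact: lexx.
rewrite (nnmf_integralD _ nI1); last exact: nnmfZ.
(* In the term where x lies in the region, the order is swapped so that y is integrated first over
   the ball around x. *)
have -> : \int[lebesgue_rV d]_y \int[lebesgue_rV d]_x (cube_weight y * (s x * close_indic x y)) =
    \int[lebesgue_rV d]_x \int[lebesgue_rV d]_y (cube_weight y * (s x * close_indic x y)).
  have [f0 mf] := nsn.
  exact: (@fubini_tonelli _ _ X X R (lebesgue_rV d) (lebesgue_rV d) _ mf f0).
have hA : \int[lebesgue_rV d]_y s y <= beta%:E * energy (P w) := region_le_energy (P w).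
apply: (@le_trans _ _ (beta%:E * (\int[lebesgue_rV d]_y s y) + beta%:E * (\int[lebesgue_rV d]_y s y))).
  rewrite (nnmf_integralZ _ ns)//; apply: leeD2r; rewrite -(nnmf_integralZ _ ns)//.
  apply: le_nnmf_integral => [||x].
  - have msw : measurable_fun setT (fun q : X * X => (q.2, q.1)) by exact: measurable_fun_pair.
    apply: (@nnmf_family _ _ X _ X (fun=> lebesgue_rV d)) (nnmf_comp nsn msw); exact: measurable_family_cst.
  - exact: nnmfZ.
  under eq_integral do rewrite muleCA.
  rewrite nnmf_integralZ//; last first.
    by apply: nnmfM; [exact: nnmf_cube_weight|exact: nnmf_close_comp].
  by rewrite muleC; apply: lee_wpmul2r => //; exact: integral_close.
have e0 : 0 <= energy (P w) := nnmf_ge0 ne w.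
apply: le_trans (leeD (lee_wpmul2l b0 hA) (lee_wpmul2l b0 hA)) _.
rewrite !muleA -EFinM -ge0_muleDl ?lee_fin ?mulr_ge0// -EFinD.
by rewrite (_ : beta * beta + beta * beta = 2 * beta ^+ 2)%R//; ring.
Qed.

(** [domP] is used twice. For the number of points close to x, it leaves an integral over x of at
    most [beta] for each point of [P w]; for the constant [beta], it bounds the expected number of
    points by c. *)
Lemma energy_dominated : \int[Pr]_w energy (P w) <= (beta * c)%:E.
Proof.
have b0 : 0 <= beta%:E by rewrite lee_fin.
pose F (p : X * N) : \bar R := \sum_(y <- p.2) close_indic p.1 y.
have nF : nnmf F.
  apply: (@nnmf_psum _ _ _ _ (fun q : X * N => q.2) (fun q : (X * N) * X => close_indic q.1.1 q.2)).
    exact: measurable_snd.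
  by apply: nnmf_close_comp => //; exact: measurableT_comp.
apply: le_trans (domP nF) _.
have nnr y : nnmf (fun x => cube_weight x * close_indic x y).
  by apply: nnmfM; [exact: nnmf_cube_weight|exact: nnmf_close_comp].
have nq : nnmf (fun q : Omega * X => cube_weight q.2 * F (phi2 q)).
  by apply: nnmfM; [exact: (nnmf_comp nnmf_cube_weight m2)|exact: nnmf_comp nF mphi2].
apply: (@le_trans _ _ (\int[Pr]_w \sum_(y <- P w) beta%:E)).
  apply: le_nnmf_integral => [||w].
  - exact: nnmf_lebesgue nq.
  - by apply: (@nnmf_point P (fun=> beta%:E)) => //; exact: nnmf_cst.
  rewrite (eq_integral (fun x => \sum_(y <- P w) (cube_weight x * close_indic x y))); last first.
    move=> x _; rewrite /F ge0_sume_distrr// => y _; exact: close_indic_ge0.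
  rewrite ge0_integral_sum//; last 2 first.
    by move=> y; exact: nnmf_mfun (nnr y).
    by move=> y x _; exact: nnmf_ge0 (nnr y) x.
  apply: le_sum_seq => y _; under eq_integral do rewrite close_indicC; exact: integral_close.
apply: le_trans (domP (nnmf_cst b0)) _.
rewrite (eq_integral (fun=> (beta * c)%:E)); last first.
  move=> w _; under eq_integral do rewrite muleC.
  by rewrite (nnmf_integralZ _ nnmf_cube_weight b0) integral_cube_weight EFinM.
rewrite integral_cst//= -[leRHS]mule1; apply: lee_wpmul2l.
  by rewrite lee_fin mulr_ge0.
exact: probability_le1.
Qed.

End papangelou.

(** * Runs of the algorithm *)

Section run.
Context {R : realType} {d : nat}.
Notation X := 'rV[R]_d.
Notation N := (config R d).

Definition to_config (A : set X) : N := fset_set A.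

Lemma to_configK (A : set X) : finite_set A -> [set` to_config A] = A.
Proof. exact: fset_setK. Qed.

Lemma in_to_config (A : set X) x : finite_set A -> (x \in to_config A) = (x \in A).
Proof. by move=> fA; rewrite /to_config in_fset_set. Qed.

Lemma measurable_to_config dO (Omega : measurableType dO) (P : Omega -> set X) :
  random_finite_set P -> measurable_fun setT (fun w => to_config (P w)).
Proof.
move=> [fP mP]; apply: measurable_configP => A mA.
rewrite (_ : _ @^-1` _ = (fun w => npoints A (P w)) @^-1` [set 0%N]).
  by rewrite -[X in measurable X]setTI; exact: mP.
have e w : npoints A (P w) = card_in A (to_config (P w)) by rewrite -npointsE to_configK.
by apply/seteqP; split => w /=; rewrite e => /card_in_eq0.
Qed.

Definition two_of T (a b : T) (i : 'I_2) : T := if i == ord0 then a else b.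

Lemma measurable_two_of (A1 A2 : set X) : measurable A1 -> measurable A2 ->
  forall i, measurable (two_of A1 A2 i).
Proof. by move=> mA1 mA2 i; rewrite /two_of; case: ifP. Qed.

Lemma trivIset_two_of (A1 A2 : set X) : A1 `&` A2 = set0 ->
  trivIset [set: 'I_2] (two_of A1 A2).
Proof.
move=> A12; apply/trivIsetP => -[[|[|//]] i] [[|[|//]] j] _ _ //= _.
by rewrite /two_of/= setIC.
Qed.

Lemma npoints_two_of Omega (P : Omega -> set X) (A1 A2 : set X) n1 n2 :
  (forall w, finite_set (P w)) ->
  [set w | forall i, npoints (two_of A1 A2 i) (P w) = two_of n1 n2 i] =
  [set w | card_in A1 (to_config (P w)) = n1 /\ card_in A2 (to_config (P w)) = n2].
Proof.
move=> finP.
have e w A : npoints A (P w) = card_in A (to_config (P w)) by rewrite -npointsE to_configK.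
apply/seteqP; split => w /=; last by move=> [h1 h2] i; rewrite e /two_of; case: ifP.
by move=> hi; have := hi ord0; have := hi ord_max; rewrite !e.
Qed.

Context dO (Omega : measurableType dO) (Pr : probability Omega R) (lambda r : R).
Variables (lambda0 : 0 < lambda) (r0 : 0 < r).
Variables P Q : nat -> Omega -> set X.
Hypothesis prs : partial_rejection_sampling Pr lambda r P Q.

Let c := intensity d lambda r.
Let c0 : 0 <= c. Proof. by apply: intensity_ge0 => //; exact: ltW. Qed.

Let p t w := to_config (P t w).
Let q t w := to_config (Q t w).

Let finQ t w : finite_set (Q t w).
Proof. by have [_ /(_ t) [[+ _] _ _] _] := prs; exact. Qed.

Let finP t w : finite_set (P t w).
Proof.
have [[[f0 _] _ _] _ PS] := prs; elim: t => [|t IH]; first exact: f0.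
by rewrite PS finite_setU; split; [exact: finite_setD|exact: finQ].
Qed.

Let setp t w : P t w = [set` p t w].
Proof. by rewrite to_configK. Qed.

Let pS t w : p t.+1 w = resample r (p t w) (q t w).
Proof.
have [_ _ PS] := prs; apply/fsetP => x.
rewrite in_fsetU in_good in_to_config// PS; apply/idP/orP.
  move=> /set_mem[[Px nb]|Qx]; last by right; rewrite in_to_config//; exact/mem_set.
  left; have xp : x \in p t w by rewrite in_to_config//; exact/mem_set.
  rewrite xp/=; apply/negPn/negP => ni; apply: nb.
  by rewrite setp BadPointsE/= in_bad xp.
case=> [/andP[xp ix]|xq]; apply/mem_set; [left|right].
  split; first by rewrite setp.
  by rewrite setp BadPointsE/= in_bad xp ix.
by move: xq; rewrite in_to_config// => /set_mem.
Qed.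

Let mq t : measurable_fun setT (q t).
Proof. by have [_ /(_ t) [+ _ _] _] := prs; exact: measurable_to_config. Qed.

Let mp t : measurable_fun setT (p t).
Proof.
elim: t => [|t IH]; first by have [[+ _ _] _ _] := prs; exact: measurable_to_config.
rewrite (_ : p t.+1 = fun w => resample r (p t w) (q t w)); last exact/funext.
by apply: measurable_fsetU => //; exact: measurable_good.
Qed.

Let qp t w x : x \in q t w -> region r (p t w) x.
Proof.
rewrite in_to_config// => /set_mem Qx.
have [_ /(_ t) [_ /(_ w x Qx)]] := prs.
by rewrite setp resampling_regionE.
Qed.

(** Conditioning is only ever on the current configuration. Its avoidance events are zero counts at
    time t, hence generators of the history. *)
Let history_p t E : measurable E -> history P t (p t @^-1` E).
Proof.
suff : measurable `<=` [set E | history P t (p t @^-1` E)] by exact.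
apply: smallest_sub; first split.
- exact: sigma_algebra0.
- move=> B hB; rewrite /= setTD preimage_setC -setTD.
  exact: sigma_algebraCD.
- by move=> F hF; rewrite /= preimage_bigcup; exact: sigma_algebra_bigcup.
move=> _ [A mA <-] /=; apply: sub_sigma_algebra.
exists t, A, 0%N; split => //; apply/seteqP; split => w /=.
  by move=> /card_in_eq0; rewrite setp npointsE.
by rewrite setp npointsE => /card_in_eq0.
Qed.

Let counts_q t A1 A2 n1 n2 E : measurable A1 -> measurable A2 ->
  A1 `&` A2 = set0 -> measurable E ->
  (Pr (p t @^-1` E `&` [set w | card_in A1 (q t w) = n1 /\ card_in A2 (q t w) = n2]) =
  \int[Pr]_(w in p t @^-1` E)
    (poisson_mass (region_mass c (region r) A1 (p t w)) n1 *
     poisson_mass (region_mass c (region r) A2 (p t w)) n2)%:E)%E.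
Proof.
move=> mA1 mA2 A12 mE; have [_ /(_ t) [_ _ h] _] := prs.
have := h 2%N (two_of A1 A2) (two_of n1 n2) _ (measurable_two_of mA1 mA2)
  (trivIset_two_of A12) (@history_p t E mE).
rewrite npoints_two_of// => ->; apply: eq_integral => w _.
by rewrite !big_ord_recl big_ord0 mulr1 /region_mass setp resampling_regionE.
Qed.

Let counts_p0 A1 A2 n1 n2 : measurable A1 -> measurable A2 -> A1 `&` A2 = set0 ->
  (Pr [set w | card_in A1 (p 0%N w) = n1 /\ card_in A2 (p 0%N w) = n2] =
    (poisson_mass (region_mass c (fun=> unit_cube R d) A1 fset0) n1 *
     poisson_mass (region_mass c (fun=> unit_cube R d) A2 fset0) n2)%:E)%E.
Proof.
move=> mA1 mA2 A12; have [[_ _ h] _ _] := prs.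
have := h 2%N (two_of A1 A2) (two_of n1 n2) (measurable_two_of mA1 mA2) (trivIset_two_of A12).
by rewrite npoints_two_of// => ->; rewrite !big_ord_recl big_ord0 mulr1.
Qed.

Let dominated_p0 : intensity_dominated Pr c (p 0%N).
Proof.
move=> F nF.
have mS : measurable [set x : X * N | unit_cube R d x.1].
  exact: (measurable_preimage (@measurable_fst _ _ X N) (@measurable_cube R d)).
have nF' : nnmf (fun x : (X * N) * N => F (x.1.1, x.2)).
  apply: (nnmf_comp nF); apply: measurable_fun_pair => //.
  by apply: measurableT_comp => //; exact: measurable_fst.
(* The initial sample is treated as a fresh one with a deterministic past: [Y] is constantly empty
   and the region is the whole cube, so events of [Y] are either everything or empty. *)
have := @mecke R d dO Omega Pr c c0 (fun=> unit_cube R d) mS (fun=> @subset_refl _ _)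
  (fun=> fset0) (p 0%N) (@measurable_cst _ _ _ _ _ _) (mp 0%N) _ _ nF'.
move=> /= ->//.
move=> A1 A2 n1 n2 E mA1 mA2 A12 mE; rewrite preimage_cst.
case: ifPn => _; last by rewrite set0I measure0 integral_set0.
rewrite setTI counts_p0//.
by rewrite integral_cst// [X in (_ * X)%E]probability_setT mule1.
Qed.

Let beta := 2 ^+ d * lambda.
Let beta0 : 0 <= beta. Proof. by rewrite mulr_ge0 ?exprn_ge0// ltW. Qed.

Let ball_beta (x : X) : (c%:E * lebesgue_rV d [set y | close r x y] <= beta%:E)%E.
Proof.
rewrite [X in (_ * X)%E]lebesgue_rV_ball ?mulr_gt0// -EFinM lee_fin.
by apply: intensity_ball => //; exact: ltW.
Qed.

Let pSE t : p t.+1 = fun w => resample r (p t w) (q t w). Proof. exact/funext. Qed.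

Let dominated_p t : intensity_dominated Pr c (p t).
Proof.
elim: t => [//|t IH]; rewrite pSE.
apply: (dominated_resample c0 (mp t) (mq t)) => //; [exact: qp|exact: counts_q].
Qed.

Lemma expected_energy t :
  (\int[Pr]_w energy r (p t w) <= ((2 * beta ^+ 2) ^+ t * (beta * c))%:E)%E.
Proof.
elim: t => [|t IH].
  rewrite expr0 mul1r; exact: (energy_dominated c0 (mp 0%N) (@dominated_p 0%N) beta0 ball_beta).
rewrite pSE; apply: (le_trans (energy_resample c0 (mp t) (mq t) (@qp t) (@counts_q t) (@dominated_p t) beta0 ball_beta)).
rewrite (exprS _ t) -mulrA [leRHS]EFinM; apply: lee_wpmul2l => //.
by rewrite lee_fin mulr_ge0// exprn_ge0.
Qed.

Lemma energy_ge1 (eta : N) : bad r eta != fset0 -> (1 <= energy r eta)%E.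
Proof.
move=> /fset0Pn[x]; rewrite in_bad => /andP[xe /allPn[y yd /negPn nxy]].
have n0 := @close_indic_ge0 R d r.
rewrite /energy; apply: le_trans (@le_sum_mem R _ _ (fun x => \sum_(y <- del x eta) close_indic r x y)%E x _ xe).
  apply: le_trans (@le_sum_mem R _ _ _ y (n0 x) yd).
  by rewrite /close_indic nxy.
by move=> z; apply: sume_ge0 => u _; exact: n0.
Qed.

(** Each time from n on at which bad points remain adds at least 1 to the series. If none of these
    times is free of bad points, the series is infinite. *)
Lemma iterations_le n w :
  (iterations r P w <= n%:R%:E + \sum_(0 <= t <oo) energy r (p (n + t)%N w))%E.
Proof.
have e0 t : (0 <= energy r (p t w))%E := nnmf_ge0 (nnmf_energy r) (p t w).
have BE t : BadPoints r (P t w) = set0 <-> bad r (p t w) = fset0.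
  rewrite setp BadPointsE; split => [h|->]; last by apply/seteqP; split.
  apply/fsetP => x; rewrite in_fset0; apply/negP => xb.
  by have : [set` bad r (p t w)] x by []; rewrite h.
have ge m : (forall t, (t < m)%N -> bad r (p (n + t)%N w) != fset0) ->
    (m%:R%:E <= \sum_(0 <= t <oo) energy r (p (n + t)%N w))%E.
  move=> hb; apply: le_trans (nneseries_lim_ge m _); last by move=> k _ _; exact: e0.
  have -> : (m%:R%:E = \sum_(0 <= t < m) (1%R)%:E :> \bar R)%E.
    by rewrite sumEFin sumr_const_nat subn0.
  by rewrite big_nat [leRHS]big_nat; apply: lee_sum => k km; apply: energy_ge1; exact: hb.
have [ht|nt] := pselect (exists t, bad r (p (n + t)%N w) == fset0).
  (* m is the first delay after n without bad points. The run may have stopped before time n, but n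
     + m still bounds the infimum from above. *)
  have [m /eqP hm hmin] := ex_minnP ht.
  apply: (@le_trans _ _ (n + m)%:R%:E).
    by apply: ereal_inf_lbound; exists (n + m)%N => //; exact/BE.
  rewrite natrD EFinD; apply: leeD2l; apply: ge => k km.
  by apply/negP => /hmin; rewrite leqNgt km.
suff -> : (\sum_(0 <= t <oo) energy r (p (n + t)%N w) = +oo)%E by rewrite addey ?leey.
apply/eqyP => A A0; apply: (@le_trans _ _ (Num.truncn A).+1%:R%:E).
  by rewrite lee_fin ltW// truncnS_gt.
by apply: ge => k _; apply/negP => h; apply: nt; exists k.
Qed.

Lemma iterations_ge0 w : (0 <= iterations r P w)%E.
Proof. by apply: le_ereal_inf_tmp => _ [t _ <-]; rewrite lee_fin. Qed.

(** The expected energies from time n on are bounded by a geometric series of ratio 2 beta ^ 2. The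
    time n stays free, to be matched to r later. *)
Lemma expected_iterations n : 2 * beta ^+ 2 < 1 ->
  (\int[Pr]_w iterations r P w <=
   (n%:R + (2 * beta ^+ 2) ^+ n * (beta * c) / (1 - 2 * beta ^+ 2))%:E)%E.
Proof.
set alpha := 2 * beta ^+ 2 => alpha1.
have alpha0 : 0 <= alpha by rewrite mulr_ge0// exprn_ge0.
have nE t : nnmf (fun w => energy r (p t w)) := nnmf_comp (nnmf_energy r) (mp t).
apply: (le_trans (ge0_le_integral_nonmeasurable _ iterations_ge0 (iterations_le n))).
rewrite nnmf_integralD; last 2 first.
  by apply: nnmf_cst; rewrite lee_fin.
  split; first by move=> w; apply: nneseries_ge0 => t _ _; exact: nnmf_ge0 (nE _) w.
  by apply: ge0_emeasurable_sum => [t w _ _|t _]; [exact: nnmf_ge0 (nE _) w|exact: nnmf_mfun (nE _)].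
rewrite integral_cst// [X in (_ * X + _)%E]probability_setT mule1 [leRHS]EFinD; apply: leeD2l.
rewrite integral_nneseries//; last 2 first.
  by move=> t; exact: nnmf_mfun (nE _).
  by move=> t w _; exact: nnmf_ge0 (nE _) w.
apply: (@le_trans _ _ (\sum_(0 <= t <oo) (geometric (alpha ^+ n * (beta * c)) alpha t)%:E)%E).
  apply: lee_nneseries => t _.
    by move=> _; apply: integral_ge0 => w _; exact: nnmf_ge0 (nE _) w.
  apply: le_trans (expected_energy _) _.
  by rewrite lee_fin -/alpha exprD /geometric/= mulrAC.
have aa : `|alpha| < 1 by rewrite ger0_norm.
rewrite (_ : (\sum_(0 <= t <oo) _)%E =
    (limn (series (geometric (alpha ^+ n * (beta * c)) alpha)))%:E).
  by rewrite lee_fin (cvg_lim _ (@cvg_geometric_series R _ _ aa)).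
rewrite -EFin_lim; last exact: is_cvg_geometric_series.
by congr (limn _); apply/funext => m /=; rewrite sumEFin.
Qed.

End run.

(** * The threshold on lambda and the choice of constants *)

(** The threshold is the value of lambda at which 2 (2 ^ d lambda) ^ 2 equals 1, that is lambda ^ 2
    = 2 ^ -(2 d + 1). *)
Lemma powR_half_square (R : realType) (d : nat) (lambda : R) : 0 < lambda ->
  lambda < 2 `^ (- (d%:R + 2^-1)) -> 2 * (2 ^+ d * lambda) ^+ 2 < 1.
Proof.
move=> l0 ll.
have h : lambda ^+ 2 < (2 `^ (- (d%:R + 2^-1))) ^+ 2.
  by rewrite ltr_pXn2r// nnegrE ltW// ltW.
have e : (2 `^ (- (d%:R + 2^-1))) ^+ 2 = (2 ^+ (d + d).+1)^-1 :> R.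
  rewrite -powR_mulrn ?powR_ge0// -powRrM -powR_invn//; congr (_ `^ _).
  by rewrite -[(d + d).+1%:R]natr1 natrD; field.
rewrite e in h.
have p0 : 0 < 2 ^+ (d + d).+1 :> R by rewrite exprn_gt0.
have : 2 ^+ (d + d).+1 * lambda ^+ 2 < 1.
  by rewrite -ltr_pdivlMl// mulr1.
by rewrite (_ : 2 * (2 ^+ d * lambda) ^+ 2 = 2 ^+ (d + d).+1 * lambda ^+ 2)// (exprS _ (d + d)) exprD; ring.
Qed.

Theorem mainTheorem3 (R : realType) (d : nat) (lambda : R)
    (d_ge3 : (3 <= d)%N) (lambda_gt0 : 0 < lambda)
    (lambda_lt : lambda < 2 `^ (- (d%:R + 2^-1))) :
  exists C r0 : R, [/\ 0 < C, 0 < r0 < 1 &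
    forall r : R, 0 < r <= r0 ->
    forall (dO : measure_display) (Omega : measurableType dO)
      (Pr : probability Omega R) (P Q : nat -> Omega -> set 'rV[R]_d),
      partial_rejection_sampling Pr lambda r P Q ->
      (\int[Pr]_w iterations r P w <= (C * ln r^-1)%:E)%E].
Proof.
set beta := 2 ^+ d * lambda; pose alpha := 2 * beta ^+ 2.
have beta0 : 0 < beta by rewrite mulr_gt0// exprn_gt0.
have alpha1 : alpha < 1 by exact: powR_half_square.
have alpha0 : 0 < alpha by rewrite mulr_gt0// exprn_gt0.
pose v := unit_ball_volume R d.
have v0 : 0 <= v by exact: unit_ball_volume_ge0.
pose K := beta * (lambda / v) / (1 - alpha).
have K0 : 0 <= K.
  by rewrite divr_ge0 ?subr_ge0 ?(ltW alpha1)// mulr_ge0 ?divr_ge0// ltW.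
pose a := - ln alpha.
have a0 : 0 < a by rewrite oppr_gt0 ln_lt0// alpha0.
have d0 : 0 <= d%:R / a by rewrite divr_ge0// ltW.
(* The three terms come from the waiting time d L / a, from rounding it up to an integer, and from
   the geometric tail K. Taking r at most 1 / e makes L = ln (1 / r) at least 1, so the constants 1
   and K are at most L and K L. *)
exists (d%:R / a + 1 + K), (expR (- 1)); split.
- by rewrite ltr_wpDr// ltr_wpDl.
- by rewrite expR_gt0/= -expR0 ltr_expR oppr_lt0.
move=> r /andP[r0 rr] dO Omega Pr P Q prs.
pose L := ln r^-1.
have L1 : 1 <= L.
  by rewrite /L lnV ?posrE// lerNr -(expRK (-1)) ler_ln ?posrE ?expR_gt0.
(* Chosen so that alpha ^ n <= r ^ d, which cancels the factor r ^ -d of the intensity and bounds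
   the tail by K uniformly in r. *)
pose n := (Num.truncn (d%:R * L / a)).+1.
have x0 : 0 <= d%:R * L / a by rewrite divr_ge0 ?mulr_ge0// ltW// (lt_le_trans ltr01).
have n1 : d%:R * L / a < n%:R by exact: truncnS_gt.
have n2 : n%:R <= d%:R * L / a + 1.
  by rewrite /n -natr1 lerD2r; by rewrite truncn_le.
have an : alpha ^+ n <= r ^+ d.
  rewrite -(lnK (x := alpha)) ?posrE// -(lnK (x := r)) ?posrE// -!expRM_natl ler_expR.
  have : d%:R * L <= n%:R * a by rewrite -ler_pdivrMr// ltW.
  by rewrite /L /a lnV ?posrE// !mulrN lerN2.
apply: le_trans (expected_iterations lambda_gt0 r0 prs n alpha1) _.
rewrite lee_fin -/beta -/alpha.
have h : alpha ^+ n * (beta * intensity d lambda r) / (1 - alpha) <= K.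
  rewrite /K ler_pM2r ?invr_gt0 ?subr_gt0// /intensity -/v.
  have E (x y l z w : R) : x * (y * (l * (z * w))) = y * (l * z) * (x * w) by ring.
  rewrite invfM E.
  apply: ler_piMr; first by rewrite mulr_ge0 ?divr_ge0// ltW.
  by rewrite ler_pdivrMr ?exprn_gt0// mul1r.
rewrite -/L.
have -> : (d%:R / a + 1 + K) * L = d%:R * L / a + L + K * L by ring.
apply: lerD; first by apply: (le_trans n2); rewrite lerD2l.
by apply: (le_trans h); rewrite ler_peMr.
Qed.
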